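(* Let $0<q<1$, $a\in\mathbb{R}$ and $t=q^a-q^{-a}$. Any unitary basic $U_q(\mathfrak{sl}(2,\mathbb{R})_t)$-module is unitarily equivalent to one of the following mutually inequivalent $*$-representations: (1) The module $L_{\lambda,b}$ for some $b\in(a-2,a]$ and $\lambda\in\mathbb{R}$ with $-\{a+b'+1\}<\lambda<\{a-b-1\}$, where $b'\in(-a-2,-a]$ is uniquely determined by $b'-b\in2\mathbb{Z}$. In this case the (images of the) $e_c$ with $c\in b+2\mathbb{Z}$ form a basis of $L_{\lambda,b}$. (2) The module $L_{\lambda,b}$ with either $b>-a$ and $\lambda=-\{a+b-1\}$, or $b>a$ and $\lambda=\{a-b+1\}$. In this case the $e_c$ with $c\in b+2\mathbb{Z}_{\ge0}$ form a basis of $L_{\lambda,b}$. (3) The module $L_{\lambda,b}$ with either $b<-a$ and $\lambda=-\{a+b+1\}$, or $b<a$ and $\lambda=\{a-b-1\}$. In this case the $e_c$ with $c\in b-2\mathbb{Z}_{\ge0}$ form a basis of $L_{\lambda,b}$. (4) The module $L_{\lambda,b}$ with either $b=-a$ and $\lambda=-(q^{-1}+q)$, or $b=a$ and $\lambda=q^{-1}+q$. In this case $L_{\lambda,b}$ is one-dimensional.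
   Context: Notation: for $x\in\mathbb{R}$, $[x]=\frac{q^{-x}-q^{x}}{q^{-1}-q}$ and $\{x\}=q^x+q^{-x}$. The $*$-algebra. $U_q(\mathfrak{sl}(2,\mathbb{R})_t)$ is the universal unital $*$-algebra over $\mathbb{C}$ generated by $X_t,Y_t,Z_t,B_t$ with $X_t^*=Y_t$, $Z_t^*=Z_t$, $B_t^*=-B_t$ and $X_tZ_t=q^2Z_tX_t$, $Y_tZ_t=q^{-2}Z_tY_t$, $X_tY_t=1-qtZ_t-q^2Z_t^2$, $Y_tX_t=1-q^{-1}tZ_t-q^{-2}Z_t^2$, $B_tX_t=q^2X_tB_t+q((q+q^{-1})Z_t+t)$, $B_tY_t=q^{-2}Y_tB_t+q^{-1}((q+q^{-1})Z_t+t)$, $B_tZ_t=Z_tB_t-(X_t+Y_t)$. Let $U_q(\mathfrak{m}_t)$ be the subalgebra generated by $X_t,Y_t,Z_t$ and $U_q(\mathfrak{k}_t)=\mathbb{C}[B_t]$ the (polynomial) subalgebra generated by $B_t$; multiplication $U_q(\mathfrak{m}_t)\otimes U_q(\mathfrak{k}_t)\to U_q(\mathfrak{sl}(2,\mathbb{R})_t)$ is a linear bijection. The element $\Omega_t=iq^{-1}X_t+(q-q^{-1})iZ_tB_t-iqY_t$ is central and self-adjoint. For $c\in\mathbb{R}$ put $T_c^+=iq^cX_t-(q+q^{-1})Z_t+iq^{-c}Y_t-t$, $T_c^-=-iq^{-c}X_t-(q+q^{-1})Z_t-iq^{c}Y_t-t$, $A_c=iq^{-1}X_t+(q^c-q^{-c})Z_t-iqY_t$,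 and for integers $n\ge 0$, $T_c^{+,(n)}=T^+_{c+2n-2}\cdots T^+_{c+2}T^+_c$, $T_c^{-,(n)}=T^-_{c-2n+2}\cdots T^-_{c-2}T^-_c$ (equal to $1$ for $n=0$). Basic modules. For $\lambda\in\mathbb{R}$, a $U_q(\mathfrak{sl}(2,\mathbb{R})_t)$-module $(V,\pi)$ is $\lambda$-basic if it has a cyclic $\pi(iB_t)$-eigenvector and $\pi(\Omega_t)=\lambda\,\mathrm{id}_V$. It is unitary if there is a positive definite sesquilinear form on $V$ which is $*$-invariant: $\langle\xi,\pi(x)\eta\rangle=\langle\pi(x^* )\xi,\eta\rangle$ for all $\xi,\eta\in V$ and all $x$ in the algebra. A unitary basic module is a unitary $\lambda$-basic module for some $\lambda\in\mathbb{R}$ (considered with such a form). The modules $L_{\lambda,b}$. For $\lambda,b\in\mathbb{R}$ let $\mathbb{C}_b$ be the one-dimensional $U_q(\mathfrak{k}_t)$-module on which $iB_t$ acts by $[b]$. Identify $U_q(\mathfrak{sl}(2,\mathbb{R})_t)\otimes_{U_q(\mathfrak{k}_t)}\mathbb{C}_b\cong U_q(\mathfrak{m}_t)$ as vector spaces. The left ideal $I_{\lambda,b}=U_q(\mathfrak{m}_t)(A_b-\lambda)$ is a $U_q(\mathfrak{sl}(2,\mathbb{R})_t)$-submodule, and $M_{\lambda,b}=U_q(\mathfrak{m}_t)/I_{\lambda,b}$. With $\widehat 1$ the class of $1$, put $e_{b+2n}=T_b^{+,(n)}\widehat1$ and $e_{b-2n}=T_b^{-,(n)}\widehat1$ for $n\ge0$;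 the $e_c$, $c\in b+2\mathbb{Z}$, form a basis of $M_{\lambda,b}$, and $e_c$ is an $iB_t$-eigenvector at eigenvalue $[c]$. There is a unique $*$-invariant sesquilinear form on $M_{\lambda,b}$ with $\langle e_b,e_b\rangle=1$; its kernel $N_{\lambda,b}$ is a submodule, and $L_{\lambda,b}=M_{\lambda,b}/N_{\lambda,b}$ with the induced non-degenerate $*$-invariant form. The images of the $e_c$ in $L_{\lambda,b}$ are again denoted $e_c$. *)

(* Defs.v *)
From HB Require Import structures.
From mathcomp Require Import all_boot all_order all_algebra.
From mathcomp Require Import boolp classical_sets reals exp.
From mathcomp.real_closed Require Import complex.
From mathcomp Require Import ring lra.

Set Implicit Arguments.
Unset Strict Implicit.
Unset Printing Implicit Defensive.

Import Order.TTheory GRing.Theory Num.Theory.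

Local Open Scope ring_scope.
Local Open Scope quotient_scope.
Local Open Scope complex_scope.

Section QNumbers.
Variables (R : realType) (q : R).

Definition qbrack (x : R) : R := (q `^ (- x) - q `^ x) / (q^-1 - q).
Definition qbrace (x : R) : R := q `^ x + q `^ (- x).

End QNumbers.

Section GeneratedSubmodule.
Variables (A : pzRingType) (V : lmodType A) (S : set V).

Inductive in_span : V -> Prop :=
| span_gen x : S x -> in_span x
| span_zero : in_span 0
| span_add x y : in_span x -> in_span y -> in_span (x + y)
| span_scale a x : in_span x -> in_span (a *: x).

Definition span_pred : {pred V} := fun x => `[< in_span x >].

Lemma span_predP x : reflect (in_span x) (x \in span_pred).
Proof. exact: asboolP. Qed.

Lemma span_zmod_closed : zmod_closed span_pred.
Proof.
split; first by apply/span_predP/span_zero.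
move=> x y /span_predP hx /span_predP hy; apply/span_predP.
by apply: span_add => //; rewrite -scaleN1r; apply: span_scale.
Qed.

HB.instance Definition _ := GRing.isZmodClosed.Build V span_pred
  span_zmod_closed.

Definition quotmod := Quotient.quot span_pred.

HB.instance Definition _ := GRing.Zmodule.on quotmod.

Definition qclass (x : V) : quotmod := \pi_(Quotient.quot span_pred) x.
Definition qrepr (x : quotmod) : V := repr (x : Quotient.quot span_pred).

Lemma qreprK x : qclass (qrepr x) = x.
Proof. exact: reprK. Qed.

Lemma qclassP x y : reflect (in_span (x - y)) (qclass x == qclass y).
Proof. by rewrite /qclass -Quotient.idealrBE; exact: span_predP. Qed.

Lemma qclass_zmod_morphism : zmod_morphism qclass.
Proof. by move=> x y; rewrite /qclass raddfB. Qed.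

HB.instance Definition _ := GRing.isZmodMorphism.Build V quotmod qclass
  qclass_zmod_morphism.

Definition qscale (a : A) (x : quotmod) : quotmod := qclass (a *: qrepr x).

Lemma qscaleE a x : qscale a (qclass x) = qclass (a *: x).
Proof.
apply/eqP/qclassP; rewrite -scalerBr; apply: span_scale.
by apply/qclassP; rewrite qreprK.
Qed.

Lemma qscaleA a b v : qscale a (qscale b v) = qscale (a * b) v.
Proof. by rewrite -[v]qreprK !qscaleE scalerA. Qed.

Lemma qscale1 : left_id 1 qscale.
Proof. by move=> v; rewrite -[v]qreprK !qscaleE scale1r. Qed.

Lemma qscaleDr : right_distributive qscale +%R.
Proof.
move=> a u v; rewrite -[u]qreprK -[v]qreprK -raddfD !qscaleE.
by rewrite scalerDr raddfD.
Qed.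

Lemma qscaleDl v : {morph qscale^~ v : a b / a + b}.
Proof. by move=> a b; rewrite -[v]qreprK !qscaleE scalerDl raddfD. Qed.

HB.instance Definition _ := GRing.Zmodule_isLmodule.Build A quotmod
  qscaleA qscale1 qscaleDr qscaleDl.

Lemma qclass_scalable : scalable qclass.
Proof. by move=> a x; rewrite -qscaleE. Qed.

HB.instance Definition _ := GRing.isScalable.Build A V quotmod *:%R qclass
  qclass_scalable.

End GeneratedSubmodule.

Section Algebra.
Variables (R : realType) (q t : R).
Local Notation C := (R[i]).

Inductive ugen := GX | GY | GZ | GB.

(** Formal *-polynomials; the universal unital *-algebra with a given
    presentation is their quotient by the least congruence containing the
    axioms of unital complex *-algebras and the given relations. *)
Inductive uterm :=
| TGen of ugen
| TCst of C
| TAdd of uterm & uterm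
| TMul of uterm & uterm
| TStar of uterm.

HB.instance Definition _ := gen_eqMixin uterm.
HB.instance Definition _ := gen_choiceMixin uterm.

Declare Scope uterm_scope.
Delimit Scope uterm_scope with U.
Local Notation X := (TGen GX).
Local Notation Y := (TGen GY).
Local Notation Z := (TGen GZ).
Local Notation B := (TGen GB).
Local Notation "# r" := (TCst r%:C) (at level 2, r at level 1) : uterm_scope.
Local Notation "x + y" := (TAdd x y) : uterm_scope.
Local Notation "x * y" := (TMul x y) : uterm_scope.
Local Notation "x - y" := (TAdd x (TMul (TCst (-1)) y)) : uterm_scope.

Inductive urel : uterm -> uterm -> Prop :=
| rel_starX : urel (TStar X) Y
| rel_starZ : urel (TStar Z) Z
| rel_starB : urel (TStar B) (TMul (TCst (-1)) B)
| rel_XZ : urel (X * Z)%U (#(q ^+ 2) * (Z * X))%U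
| rel_YZ : urel (Y * Z)%U (#(q ^- 2) * (Z * Y))%U
| rel_XY : urel (X * Y)%U (#1 - #(q * t) * Z - #(q ^+ 2) * (Z * Z))%U
| rel_YX : urel (Y * X)%U (#1 - #(q^-1 * t) * Z - #(q ^- 2) * (Z * Z))%U
| rel_BX : urel (B * X)%U
    (#(q ^+ 2) * (X * B) + #q * (#(q + q^-1) * Z + #t))%U
| rel_BY : urel (B * Y)%U
    (#(q ^- 2) * (Y * B) + #(q^-1) * (#(q + q^-1) * Z + #t))%U
| rel_BZ : urel (B * Z)%U (Z * B - (X + Y))%U.

Inductive ueq : uterm -> uterm -> Prop :=
| ueq_rel x y : urel x y -> ueq x y
| ueq_refl x : ueq x x
| ueq_sym x y : ueq x y -> ueq y x
| ueq_trans y x z : ueq x y -> ueq y z -> ueq x z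
| ueq_add x x' y y' : ueq x x' -> ueq y y' -> ueq (TAdd x y) (TAdd x' y')
| ueq_mul x x' y y' : ueq x x' -> ueq y y' -> ueq (TMul x y) (TMul x' y')
| ueq_star x x' : ueq x x' -> ueq (TStar x) (TStar x')
| ueq_addA x y z : ueq (TAdd x (TAdd y z)) (TAdd (TAdd x y) z)
| ueq_addC x y : ueq (TAdd x y) (TAdd y x)
| ueq_add0 x : ueq (TAdd (TCst 0) x) x
| ueq_addN x : ueq (TAdd (TMul (TCst (-1)) x) x) (TCst 0)
| ueq_mulA x y z : ueq (TMul x (TMul y z)) (TMul (TMul x y) z)
| ueq_mul1l x : ueq (TMul (TCst 1) x) x
| ueq_mulDl x y z : ueq (TMul (TAdd x y) z) (TAdd (TMul x z) (TMul y z))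
| ueq_mulDr x y z : ueq (TMul x (TAdd y z)) (TAdd (TMul x y) (TMul x z))
| ueq_cstD a b : ueq (TCst (a + b)) (TAdd (TCst a) (TCst b))
| ueq_cstM a b : ueq (TCst (a * b)) (TMul (TCst a) (TCst b))
| ueq_cstC a x : ueq (TMul (TCst a) x) (TMul x (TCst a))
| ueq_starD x y : ueq (TStar (TAdd x y)) (TAdd (TStar x) (TStar y))
| ueq_starM x y : ueq (TStar (TMul x y)) (TMul (TStar y) (TStar x))
| ueq_starK x : ueq (TStar (TStar x)) x
| ueq_starC a : ueq (TStar (TCst a)) (TCst a^*).

Definition ueqb (x y : uterm) : bool := `[< ueq x y >].

Lemma ueqb_equiv : equiv_class_of ueqb.
Proof.
split=> [x|x y|y x z]; first by apply/asboolP/ueq_refl.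
  by apply/asboolP/asboolP => /ueq_sym.
by move=> /asboolP xy /asboolP yz; apply/asboolP; apply: ueq_trans yz.
Qed.

Canonical ueqb_equivRel := EquivRelPack ueqb_equiv.

Definition Usl2 := {eq_quot ueqb}.

HB.instance Definition _ := Choice.on Usl2.

Definition ucl (x : uterm) : Usl2 := \pi_({eq_quot ueqb}) x.
Definition urepr (x : Usl2) : uterm := repr (x : {eq_quot ueqb}).

Lemma ureprK x : ucl (urepr x) = x.
Proof. exact: reprK. Qed.

Lemma uclP x y : ucl x = ucl y <-> ueq x y.
Proof.
by split=> [/eqmodP/asboolP|h] //; apply/eqmodP/asboolP.
Qed.

Lemma urepr_ucl x : ueq (urepr (ucl x)) x.
Proof. by apply/uclP; rewrite ureprK. Qed.

Definition uadd (x y : Usl2) : Usl2 := ucl (TAdd (urepr x) (urepr y)).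
Definition umul (x y : Usl2) : Usl2 := ucl (TMul (urepr x) (urepr y)).
Definition uopp (x : Usl2) : Usl2 := ucl (TMul (TCst (-1)) (urepr x)).
Definition uscale (a : C) (x : Usl2) : Usl2 := ucl (TMul (TCst a) (urepr x)).
Definition ustar (x : Usl2) : Usl2 := ucl (TStar (urepr x)).

Lemma uaddE x y : uadd (ucl x) (ucl y) = ucl (TAdd x y).
Proof. by apply/uclP/ueq_add; apply: urepr_ucl. Qed.
Lemma umulE x y : umul (ucl x) (ucl y) = ucl (TMul x y).
Proof. by apply/uclP/ueq_mul; apply: urepr_ucl. Qed.
Lemma uoppE x : uopp (ucl x) = ucl (TMul (TCst (-1)) x).
Proof. by apply/uclP/ueq_mul; [apply: ueq_refl | apply: urepr_ucl]. Qed.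
Lemma uscaleE a x : uscale a (ucl x) = ucl (TMul (TCst a) x).
Proof. by apply/uclP/ueq_mul; [apply: ueq_refl | apply: urepr_ucl]. Qed.
Lemma ustarE x : ustar (ucl x) = ucl (TStar x).
Proof. by apply/uclP/ueq_star/urepr_ucl. Qed.

Let uE := (uaddE, umulE, uoppE, uscaleE, ustarE).

Lemma uaddA : associative uadd.
Proof.
move=> x y z; rewrite -[x]ureprK -[y]ureprK -[z]ureprK !uE.
exact/uclP/ueq_addA.
Qed.

Lemma uaddC : commutative uadd.
Proof. move=> x y; rewrite -[x]ureprK -[y]ureprK !uE; exact/uclP/ueq_addC. Qed.

Lemma uadd0 : left_id (ucl (TCst 0)) uadd.
Proof. move=> x; rewrite -[x]ureprK !uE; exact/uclP/ueq_add0. Qed.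

Lemma uaddN : left_inverse (ucl (TCst 0)) uopp uadd.
Proof. move=> x; rewrite -[x]ureprK !uE; exact/uclP/ueq_addN. Qed.

HB.instance Definition _ := GRing.isZmodule.Build Usl2 uaddA uaddC uadd0 uaddN.

Lemma umulA : associative umul.
Proof.
move=> x y z; rewrite -[x]ureprK -[y]ureprK -[z]ureprK !uE.
exact/uclP/ueq_mulA.
Qed.

Lemma umul1l : left_id (ucl (TCst 1)) umul.
Proof. move=> x; rewrite -[x]ureprK !uE; exact/uclP/ueq_mul1l. Qed.

Lemma umul1r : right_id (ucl (TCst 1)) umul.
Proof.
move=> x; rewrite -[x]ureprK !uE; apply/uclP.
by apply: ueq_trans (ueq_mul1l _); apply/ueq_sym/ueq_cstC.
Qed.

Lemma umulDl : left_distributive umul uadd.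
Proof.
move=> x y z; rewrite -[x]ureprK -[y]ureprK -[z]ureprK !uE.
exact/uclP/ueq_mulDl.
Qed.

Lemma umulDr : right_distributive umul uadd.
Proof.
move=> x y z; rewrite -[x]ureprK -[y]ureprK -[z]ureprK !uE.
exact/uclP/ueq_mulDr.
Qed.

(** Witnesses 1 <> 0 in the quotient, which the library requires of algebras. *)
Section Character.
Variables (z s b : R).

Fixpoint uchar (x : uterm) : C :=
  match x with
  | TGen GX => 'i * s%:C
  | TGen GY => - ('i * s%:C)
  | TGen GZ => z%:C
  | TGen GB => 'i * b%:C
  | TCst a => a
  | TAdd x y => uchar x + uchar y
  | TMul x y => uchar x * uchar y
  | TStar x => (uchar x)^*
  end.

Hypothesis hXZ : s * z = q ^+ 2 * (z * s).
Hypothesis hYZ : s * z = q ^- 2 * (z * s).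
Hypothesis hXY : s * s = 1 - q * t * z - q ^+ 2 * (z * z).
Hypothesis hYX : s * s = 1 - q^-1 * t * z - q ^- 2 * (z * z).
Hypothesis hBX : - (b * s) = - (q ^+ 2 * (s * b)) + q * ((q + q^-1) * z + t).
Hypothesis hBY : b * s = q ^- 2 * (s * b) + q^-1 * ((q + q^-1) * z + t).

Lemma uchar_rel x y : urel x y -> uchar x = uchar y.
Proof.
case=> /=; apply/eqP; rewrite eq_complex /=; apply/andP; split; apply/eqP.
all: move: hXZ hYZ hXY hYX hBX hBY.
all: move: (q ^+ 2) (q ^- 2) (q^-1) => q2 q2V qV *; lra.
Qed.

Lemma uchar_ueq x y : ueq x y -> uchar x = uchar y.
Proof.
elim=> /=.
- exact: uchar_rel.
- by [].
- by move=> *; congruence.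
- by move=> *; congruence.
- by move=> *; congruence.
- by move=> *; congruence.
- by move=> *; congruence.
- by move=> *; rewrite addrA.
- by move=> *; rewrite addrC.
- by move=> *; rewrite add0r.
- by move=> *; rewrite mulN1r addNr.
- by move=> *; rewrite mulrA.
- by move=> *; rewrite mul1r.
- by move=> *; rewrite mulrDl.
- by move=> *; rewrite mulrDr.
- by [].
- by [].
- by move=> *; rewrite mulrC.
- by move=> *; rewrite rmorphD.
- by move=> *; rewrite rmorphM mulrC.
- by move=> *; rewrite conjcK.
- by [].
Qed.

Lemma uchar_neq0 : ~ ueq (TCst 1) (TCst 0).
Proof. by move/uchar_ueq => /= /eqP; rewrite oner_eq0. Qed.

End Character.

Lemma uone_neq0 : ucl (TCst 1) != 0.
Proof.
apply/eqP => /uclP; have [q2|q2] := eqVneq (q ^+ 2) 1.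
  pose s := Num.sqrt (1 + t ^+ 2 / 4).
  have s2 : s * s = 1 + t ^+ 2 / 4.
    by rewrite -expr2 sqr_sqrtr // addr_ge0 // divr_ge0 // sqr_ge0.
  have q0 : q != 0.
    by apply/eqP => q0; move: q2; rewrite q0 expr0n /= => /esym/eqP; rewrite oner_eq0.
  have qV : q^-1 = q by apply: (mulfI q0); rewrite divff // -expr2 q2.
  have q2' : q * q = 1 by rewrite -expr2.
  apply: (@uchar_neq0 (- (q * t / 2)) s 0); rewrite ?qV ?q2 ?invr1 ?s2; try by ring.
  - by rewrite [RHS](_ : _ = 1 + (q * q) * (t * t / 4)); [rewrite q2'|]; field.
  - by rewrite [RHS](_ : _ = 1 + (q * q) * (t * t / 4)); [rewrite q2'|]; field.
  - by rewrite [RHS](_ : _ = q * t * (1 - q * q)); [rewrite q2'|]; field.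
  - by rewrite [RHS](_ : _ = q * t * (1 - q * q)); [rewrite q2'|]; field.
have q2' : 1 - q ^+ 2 != 0 by rewrite subr_eq0 eq_sym.
apply: (@uchar_neq0 0 1 (- (q * t / (1 - q ^+ 2)))).
- by rewrite !mulr0 mul0r mulr0.
- by rewrite !mulr0 mul0r mulr0.
- by rewrite !mulr0 !subr0 mulr1.
- by rewrite !mulr0 !subr0 mulr1.
- by rewrite mulr0; field.
have [->|q0] := eqVneq q 0; first by rewrite invr0 !(mul0r, mulr0, oppr0, addr0).
by field; rewrite q2' q0.
Qed.

HB.instance Definition _ := GRing.Zmodule_isNzRing.Build Usl2
  umulA umul1l umul1r umulDl umulDr uone_neq0.

Lemma uscaleA a b v : uscale a (uscale b v) = uscale (a * b) v.
Proof.
rewrite -[v]ureprK !uE; apply/uclP.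
apply: ueq_trans (ueq_mulA _ _ _) _; apply: ueq_mul; last exact: ueq_refl.
exact/ueq_sym/ueq_cstM.
Qed.

Lemma uscale1 : left_id 1 uscale.
Proof. move=> x; rewrite -[x]ureprK !uE; exact/uclP/ueq_mul1l. Qed.

Lemma uscaleDr : right_distributive uscale uadd.
Proof. move=> a x y; rewrite -[x]ureprK -[y]ureprK !uE; exact/uclP/ueq_mulDr. Qed.

Lemma uscaleDl v : {morph uscale^~ v : a b / a + b >-> uadd a b}.
Proof.
move=> a b; rewrite -[v]ureprK !uE; apply/uclP.
apply: ueq_trans (ueq_mulDl _ _ _).
by apply: ueq_mul; [apply: ueq_cstD | apply: ueq_refl].
Qed.

HB.instance Definition _ := GRing.Zmodule_isLmodule.Build C Usl2
  uscaleA uscale1 uscaleDr uscaleDl.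

Lemma uscaleAl (a : C) (x y : Usl2) : a *: (x * y) = (a *: x) * y.
Proof.
rewrite -[x]ureprK -[y]ureprK /GRing.scale /GRing.mul /= !uE.
exact/uclP/ueq_mulA.
Qed.

HB.instance Definition _ := GRing.Lmodule_isLalgebra.Build C Usl2 uscaleAl.

Lemma uscaleAr (a : C) (x y : Usl2) : a *: (x * y) = x * (a *: y).
Proof.
rewrite -[x]ureprK -[y]ureprK /GRing.scale /GRing.mul /= !uE; apply/uclP.
apply: ueq_trans (ueq_mulA _ _ _) _.
apply: ueq_trans (ueq_sym (ueq_mulA _ _ _)).
by apply: ueq_mul; [apply: ueq_cstC | apply: ueq_refl].
Qed.

HB.instance Definition _ := GRing.Lalgebra_isAlgebra.Build C Usl2 uscaleAr.

Lemma ustarK : involutive ustar.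
Proof. move=> x; rewrite -[x]ureprK !uE; exact/uclP/ueq_starK. Qed.

Lemma ustarD x y : ustar (x + y) = ustar x + ustar y.
Proof.
rewrite -[x]ureprK -[y]ureprK; change (ustar (uadd (ucl (urepr x)) (ucl (urepr y))) =
  uadd (ustar (ucl (urepr x))) (ustar (ucl (urepr y)))).
by rewrite !uE; exact/uclP/ueq_starD.
Qed.

Lemma ustarM x y : ustar (x * y) = ustar y * ustar x.
Proof.
rewrite -[x]ureprK -[y]ureprK; change (ustar (umul (ucl (urepr x)) (ucl (urepr y))) =
  umul (ustar (ucl (urepr y))) (ustar (ucl (urepr x)))).
by rewrite !uE; exact/uclP/ueq_starM.
Qed.

Lemma ustarZ (a : C) x : ustar (a *: x) = a^* *: ustar x.
Proof.
rewrite -[x]ureprK; change (ustar (uscale a (ucl (urepr x))) =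
  uscale a^* (ustar (ucl (urepr x)))).
rewrite !uE; apply/uclP; apply: ueq_trans (ueq_starM _ _) _.
apply: ueq_trans (ueq_sym (ueq_cstC _ _)).
by apply: ueq_mul; [apply: ueq_refl | apply: ueq_starC].
Qed.

End Algebra.

Section Modules.
Variables (R : realType) (q t : R).
Local Notation C := (R[i]).
Local Notation U := (Usl2 q t).

Definition Xt : U := ucl q t (TGen R GX).
Definition Yt : U := ucl q t (TGen R GY).
Definition Zt : U := ucl q t (TGen R GZ).
Definition Bt : U := ucl q t (TGen R GB).

Definition iBt : U := ('i : C) *: Bt.

Definition Omegat : U :=
  ('i * q^-1%:C : C) *: Xt + ((q - q^-1)%:C * 'i : C) *: (Zt * Bt)
  - ('i * q%:C : C) *: Yt.

Definition Tplus (c : R) : U :=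
  ('i * (q `^ c)%:C : C) *: Xt - (q + q^-1)%:C *: Zt
  + ('i * (q `^ (- c))%:C : C) *: Yt - t%:C *: 1.

Definition Tminus (c : R) : U :=
  - (('i * (q `^ (- c))%:C : C) *: Xt) - (q + q^-1)%:C *: Zt
  - ('i * (q `^ c)%:C : C) *: Yt - t%:C *: 1.

Definition Aop (c : R) : U :=
  ('i * q^-1%:C : C) *: Xt + (q `^ c - q `^ (- c))%:C *: Zt
  - ('i * q%:C : C) *: Yt.

Fixpoint Tplus_iter (c : R) (n : nat) : U :=
  if n is m.+1 then Tplus (c + 2 * m%:R) * Tplus_iter c m else 1.

Fixpoint Tminus_iter (c : R) (n : nat) : U :=
  if n is m.+1 then Tminus (c - 2 * m%:R) * Tminus_iter c m else 1.

Section ModuleNotions.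
Variable V : lmodType U.

(** A module over the complex algebra [U] is a complex vector space through
    the scalars of [U]. *)
Definition cscale (a : C) (v : V) : V := (a%:A : U) *: v.

Definition is_basis (I : eqType) (e : I -> V) : Prop :=
  (forall v, exists (s : seq I) (k : I -> C),
     v = \sum_(i <- s) cscale (k i) (e i)) /\
  (forall (s : seq I) (k : I -> C), uniq s ->
     \sum_(i <- s) cscale (k i) (e i) = 0 -> forall i, i \in s -> k i = 0).

Definition one_dimensional : Prop :=
  exists v : V, is_basis (fun _ : unit => v).

Implicit Types (f : V -> V -> C).

(** Antilinear in the first variable, linear in the second one. *)
Definition is_sesquilinear f : Prop :=
  (forall a x y z, f x (cscale a y + z) = a * f x y + f x z) /\
  (forall a x y z, f (cscale a x + y) z = a^* * f x z + f y z).

Definition is_invariant f : Prop :=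
  forall (x : U) v w, f v (x *: w) = f (ustar x *: v) w.

Definition is_posdef f : Prop := forall v, v != 0 -> 0 < f v v.

Definition is_cyclic (v : V) : Prop := forall w, exists x : U, w = x *: v.

Definition is_basic (lam : R) : Prop :=
  (exists v : V, [/\ v != 0, exists mu : C, iBt *: v = cscale mu v
                  & is_cyclic v]) /\
  (forall v : V, Omegat *: v = cscale lam%:C v).

Definition is_unitary_form f : Prop :=
  [/\ is_sesquilinear f, is_posdef f & is_invariant f].

Definition is_unitary_basic f : Prop :=
  is_unitary_form f /\ exists lam : R, is_basic lam.

End ModuleNotions.

Definition unitarily_equivalent (V W : lmodType U)
    (f : V -> V -> C) (g : W -> W -> C) : Prop :=
  exists F : {linear V -> W},
    bijective F /\ forall v w, g (F v) (F w) = f v w.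

Inductive in_Um : U -> Prop :=
| Um_X : in_Um Xt
| Um_Y : in_Um Yt
| Um_Z : in_Um Zt
| Um_1 : in_Um 1
| Um_add x y : in_Um x -> in_Um y -> in_Um (x + y)
| Um_scale (a : C) x : in_Um x -> in_Um (a *: x)
| Um_mul x y : in_Um x -> in_Um y -> in_Um (x * y).

(** The tensor product of [U] with C_b over U_q(k_t) = C[B_t]: a polynomial
    p(B_t) acts on C_b by the scalar p(- i [b]), so that U (x) C_b is the
    quotient of U (x)_C C = U by the elements u p(B_t) - p(- i [b]) u; these
    are stable under left multiplication by U. *)
Definition ind_relations (b : R) : set (U^o) :=
  [set x : U^o | exists (u : U) (p : {poly C}),
    x = u * horner_alg Bt p - p.[- ('i * (qbrack q b)%:C)] *: u].

Definition Ind (b : R) := quotmod (ind_relations b).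
HB.instance Definition _ (b : R) := GRing.Lmodule.on (Ind b).

Definition ind_class (b : R) (u : U) : Ind b :=
  qclass (ind_relations b) (u : U^o).

(** The left ideal U_q(m_t)(A_b - lambda), transported along the
    identification u |-> u (x) 1 of U_q(m_t) with the induced module.  It is
    stable under U, so the submodule it generates is itself. *)
Definition I_ideal (lam b : R) : set (Ind b) :=
  [set v | exists2 u, in_Um u & v = ind_class b (u * (Aop b - lam%:C *: 1))].

Definition M_mod (lam b : R) := quotmod (@I_ideal lam b).
HB.instance Definition _ (lam b : R) := GRing.Lmodule.on (M_mod lam b).

Definition M_one (lam b : R) : M_mod lam b :=
  qclass (@I_ideal lam b) (ind_class b 1).

(** [M_vec lam b n] is e_{b+2n}. *)
Definition M_vec (lam b : R) (n : int) : M_mod lam b :=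
  match n with
  | Posz m => Tplus_iter b m *: M_one lam b
  | Negz m => Tminus_iter b m.+1 *: M_one lam b
  end.

Definition is_canonical_form (lam b : R)
    (f : M_mod lam b -> M_mod lam b -> C) : Prop :=
  [/\ is_sesquilinear f, is_invariant f
    & f (M_vec lam b 0) (M_vec lam b 0) = 1].

(** There is exactly one canonical form, so the default value is immaterial. *)
Definition M_form (lam b : R) : M_mod lam b -> M_mod lam b -> C :=
  xget (fun _ _ => 0) [set f | is_canonical_form f].

Definition N_kernel (lam b : R) : set (M_mod lam b) :=
  [set v | forall w, M_form v w = 0].

Definition L_mod (lam b : R) := quotmod (@N_kernel lam b).
HB.instance Definition _ (lam b : R) := GRing.Lmodule.on (L_mod lam b).

Definition L_vec (lam b : R) (n : int) : L_mod lam b :=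
  qclass (@N_kernel lam b) (M_vec lam b n).

Definition L_form (lam b : R) (v w : L_mod lam b) : C :=
  M_form (qrepr v) (qrepr w).

End Modules.

Arguments L_form {R} q t lam b v w.
Arguments L_vec {R} q t lam b n.

Section List.
Variables (R : realType) (q a : R).

Definition principal_series (lam b : R) : Prop :=
  a - 2 < b <= a /\
  exists b' : R, [/\ - a - 2 < b' <= - a,
                     exists k : int, b' - b = 2 * k%:~R
                   & - qbrace q (a + b' + 1) < lam < qbrace q (a - b - 1)].

Definition lowest_weight_series (lam b : R) : Prop :=
  (- a < b /\ lam = - qbrace q (a + b - 1)) \/
  (a < b /\ lam = qbrace q (a - b + 1)).

Definition highest_weight_series (lam b : R) : Prop :=
  (b < - a /\ lam = - qbrace q (a + b + 1)) \/
  (b < a /\ lam = qbrace q (a - b - 1)).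

Definition characters (lam b : R) : Prop :=
  (b = - a /\ lam = - (q^-1 + q)) \/ (b = a /\ lam = q^-1 + q).

Inductive series := Principal | LowestWeight | HighestWeight | Character.

Definition in_series (s : series) (lam b : R) : Prop :=
  match s with
  | Principal => principal_series lam b
  | LowestWeight => lowest_weight_series lam b
  | HighestWeight => highest_weight_series lam b
  | Character => characters lam b
  end.

End List.

(* Main.v *)
(* On a vector v with iB v = [c] v and A_c v = lam v, the operators T^+_c and
   T^-_c shift c by 2, and T^-_{c+2} T^+_c = ({a+c+1} + lam) ({a-c-1} - lam).
   Since X, Y, Z are combinations of T^+_c, T^-_c, A_c and 1, the vectors
   obtained from v by these shifts span the submodule it generates.  As
   T^-_c - ({c}/{c+2}) T^-_{c+2} is a combination of T^+_{c+2}, A_{c+2} and 1,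
   and distinct weight spaces are orthogonal, an invariant form satisfies
   |T^+_c v|^2 = ({c}/{c+2}) ({a+c+1} + lam) ({a-c-1} - lam) |v|^2.  Unitarity
   is therefore decided by the signs of these products, and the position of
   their zeros separates the four series.  The canonical form on M_{lam,b} is
   <u e_b, w> = coefficient of e_b in u^* w; that e_b is nonzero is read off a
   module of sequences on which Z is diagonal. *)

(* The algebra is known only through its presentation: no linear basis of it and no independence of
   the [e_c] in M can be read off. The annihilator of [e_b] in M is therefore computed instead, as
   the left ideal generated by iB - [b] and A_b - lam; a vector killed by these two receives a map
   from M, and one explicit nonzero such vector shows that [e_b] is nonzero. The coefficient of
   [e_b] in w is the scalar k such that w - k e_b is killed by some p(iB) with p([b]) nonzero. The
   same coefficient gives u |-> <v, u v> for every unit vector v of weight b in any module with an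
   invariant form and central value lam. This functional thus depends on lam and b only, and it
   determines a unitary cyclic module up to equivalence. In an arbitrary unitary basic module the
   given eigenvector may have the wrong weight; but when a ladder product is positive the shifted
   vector is again cyclic, so one can walk to an extremal weight or, if no shift ever vanishes, into
   the window (a-2, a]. Inequivalence is read off the scalar of Omega and the set of weights of
   iB. *)
Require Import Defs.
From HB Require Import structures.
From mathcomp Require Import all_boot all_order all_algebra.
From mathcomp Require Import boolp classical_sets reals exp.
From mathcomp.real_closed Require Import complex.
From mathcomp Require Import ring lra zify.

Set Implicit Arguments.
Unset Strict Implicit.
Unset Printing Implicit Defensive.

Import Order.TTheory GRing.Theory Num.Theory.

Local Open Scope ring_scope.

(** * Normal forms of degree at most two in the generators *)

Section Relations.
Variables (R : realType) (q t : R).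
Local Notation C := (R[i]).
Local Notation U := (Usl2 q t).
Local Open Scope complex_scope.

(** The factors i make all structure constants below real, so that identities in U reduce to
    identities between real coefficients. *)
Definition ux : U := locked (('i : C) *: Xt q t).
Definition uy : U := locked (('i : C) *: Yt q t).
Definition uz : U := locked (Zt q t).
Definition uk : U := locked (iBt q t).

Lemma uclD x y : ucl q t (TAdd x y) = ucl q t x + ucl q t y.
Proof. by rewrite -uaddE. Qed.

Lemma uclM x y : ucl q t (TMul x y) = ucl q t x * ucl q t y.
Proof. by rewrite -umulE. Qed.

Lemma uclZ a x : ucl q t (TMul (TCst a) x) = a *: ucl q t x.
Proof. by rewrite -uscaleE. Qed.

Lemma uclC a : ucl q t (TCst a) = a *: 1.
Proof.
by rewrite -uclZ; apply/uclP/(ueq_trans (ueq_sym (ueq_mul1l q t _)))/ueq_cstC.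
Qed.

Let uclE := (uclZ, uclD, uclM, uclC).

Lemma ucl_rel x y : urel q t x y -> ucl q t x = ucl q t y.
Proof. by move=> h; apply/uclP/ueq_rel. Qed.

Lemma ucl_star x : ucl q t (TStar x) = ustar (ucl q t x).
Proof. by rewrite ustarE. Qed.

Lemma sqrI : 'i * 'i = -1 :> C.
Proof. by rewrite -expr2 sqr_i. Qed.

Lemma conjI : (('i : C)^*)%R = - 'i.
Proof. by apply/eqP; rewrite eq_complex /= oppr0 !eqxx. Qed.

Lemma ustar_x : ustar ux = - uy.
Proof.
rewrite /ux /uy -!lock ustarZ conjI -ucl_star (ucl_rel (rel_starX q t)).
by rewrite scaleNr.
Qed.

Lemma ustar_y : ustar uy = - ux.
Proof.
rewrite /ux /uy -!lock ustarZ conjI /Yt -(ucl_rel (rel_starX q t)) ucl_star ustarK.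
by rewrite scaleNr.
Qed.

Lemma ustar_z : ustar uz = uz.
Proof. by rewrite /uz -!lock -ucl_star (ucl_rel (rel_starZ q t)). Qed.

Lemma ustar_k : ustar uk = uk.
Proof.
rewrite /uk -!lock /iBt ustarZ conjI -ucl_star (ucl_rel (rel_starB q t)) uclZ.
by rewrite scalerA mulrN1 opprK.
Qed.

Lemma mul_xz : ux * uz = (q ^+ 2)%:C *: (uz * ux).
Proof.
rewrite /ux /uz -!lock -scalerAl -scalerAr -uclM (ucl_rel (rel_XZ q t)) !uclE.
by rewrite !scalerA mulrC.
Qed.

Lemma mul_yz : uy * uz = (q ^- 2)%:C *: (uz * uy).
Proof.
rewrite /uy /uz -!lock -scalerAl -scalerAr -uclM (ucl_rel (rel_YZ q t)) !uclE.
by rewrite !scalerA mulrC.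
Qed.

Lemma mul_xy : ux * uy = - 1 + (q * t)%:C *: uz + (q ^+ 2)%:C *: (uz * uz).
Proof.
rewrite /ux /uy /uz -!lock -scalerAl -scalerAr scalerA sqrI -uclM.
rewrite (ucl_rel (rel_XY q t)).
by rewrite !uclE !scale1r !scaleN1r !opprD !opprK.
Qed.

Lemma mul_yx :
  uy * ux = - 1 + (q^-1 * t)%:C *: uz + (q ^- 2)%:C *: (uz * uz).
Proof.
rewrite /ux /uy /uz -!lock -scalerAl -scalerAr scalerA sqrI -uclM.
rewrite (ucl_rel (rel_YX q t)).
by rewrite !uclE !scale1r !scaleN1r !opprD !opprK.
Qed.

Lemma mul_kx : uk * ux = (q ^+ 2)%:C *: (ux * uk)
  - q%:C *: ((q + q^-1)%:C *: uz + t%:C *: 1).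
Proof.
rewrite /uk /ux /uz -!lock /iBt -!scalerAl -!scalerAr !scalerA -uclM.
rewrite (ucl_rel (rel_BX q t)) !uclE scalerDr !scalerA.
by rewrite sqrI -[_ * 'i * 'i]mulrA sqrI !mulN1r mulrN1 !scaleNr.
Qed.

Lemma mul_ky : uk * uy = (q ^- 2)%:C *: (uy * uk)
  - (q^-1)%:C *: ((q + q^-1)%:C *: uz + t%:C *: 1).
Proof.
rewrite /uk /uy /uz -!lock /iBt -!scalerAl -!scalerAr !scalerA -uclM.
rewrite (ucl_rel (rel_BY q t)) !uclE scalerDr !scalerA.
by rewrite sqrI -[_ * 'i * 'i]mulrA sqrI !mulN1r mulrN1 !scaleNr.
Qed.

Lemma mul_kz : uk * uz = uz * uk - ux - uy.
Proof.
rewrite /uk /ux /uy /uz -!lock /iBt -!scalerAl -!scalerAr -uclM.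
rewrite (ucl_rel (rel_BZ q t)) !uclE !scaleN1r scalerDr scalerN scalerDr.
by rewrite opprD addrA.
Qed.

Definition lin (a b c d : R) : U :=
  locked (a%:C *: ux + b%:C *: uy + c%:C *: uz + d%:C *: 1).

(** Normal form in degree two: [uz] is moved to the left, and [ux * uy] and [uy * ux] are replaced
    by polynomials in [uz]. Equality is then checked coefficient by coefficient. *)
Definition quad (a1 a2 a3 a4 a5 a6 a7 a8 a9 : R) : U :=
  locked (a1%:C *: (ux * ux) + a2%:C *: (uy * uy) + a3%:C *: (uz * uz)
  + a4%:C *: (uz * ux) + a5%:C *: (uz * uy)
  + a6%:C *: ux + a7%:C *: uy + a8%:C *: uz + a9%:C *: 1).

Lemma linD a b c d a' b' c' d' : lin a b c d + lin a' b' c' d' =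
  lin (a + a') (b + b') (c + c') (d + d').
Proof.
rewrite /lin -!lock !raddfD /= !scalerDl.
by do 3![rewrite [LHS]addrACA; congr (_ + _)].
Qed.

Lemma linZ r a b c d : r%:C *: lin a b c d =
  lin (r * a) (r * b) (r * c) (r * d).
Proof. by rewrite /lin -!lock !scalerDr !scalerA !rmorphM. Qed.

Lemma quadD a1 a2 a3 a4 a5 a6 a7 a8 a9 b1 b2 b3 b4 b5 b6 b7 b8 b9 :
  quad a1 a2 a3 a4 a5 a6 a7 a8 a9 + quad b1 b2 b3 b4 b5 b6 b7 b8 b9 =
  quad (a1 + b1) (a2 + b2) (a3 + b3) (a4 + b4) (a5 + b5) (a6 + b6)
    (a7 + b7) (a8 + b8) (a9 + b9).
Proof.
rewrite /quad -!lock !raddfD /= !scalerDl.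
by do 8![rewrite [LHS]addrACA; congr (_ + _)].
Qed.

Lemma quadZ r a1 a2 a3 a4 a5 a6 a7 a8 a9 :
  r%:C *: quad a1 a2 a3 a4 a5 a6 a7 a8 a9 =
  quad (r * a1) (r * a2) (r * a3) (r * a4) (r * a5) (r * a6)
    (r * a7) (r * a8) (r * a9).
Proof. by rewrite /quad -!lock !scalerDr !scalerA !rmorphM. Qed.

Lemma lin_quad a b c d : lin a b c d = quad 0 0 0 0 0 a b c d.
Proof. by rewrite /lin /quad -!lock !scale0r !add0r. Qed.

Let quadE := (quadZ, quadD).

Lemma lin_mul a b c d a' b' c' d' : lin a b c d * lin a' b' c' d' =
  quad (a * a') (b * b') (c * c' + a * b' * q ^+ 2 + b * a' * q ^- 2)
    (c * a' + a * c' * q ^+ 2) (c * b' + b * c' * q ^- 2)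
    (a * d' + d * a') (b * d' + d * b')
    (c * d' + d * c' + a * b' * (q * t) + b * a' * (q^-1 * t))
    (d * d' - a * b' - b * a').
Proof.
have xx : ux * ux = quad 1 0 0 0 0 0 0 0 0.
  by rewrite /quad -!lock !scale0r !addr0 scale1r.
have yy : uy * uy = quad 0 1 0 0 0 0 0 0 0.
  by rewrite /quad -!lock !scale0r !addr0 add0r scale1r.
have zz : uz * uz = quad 0 0 1 0 0 0 0 0 0.
  by rewrite /quad -!lock !scale0r !addr0 !add0r scale1r.
have zx : uz * ux = quad 0 0 0 1 0 0 0 0 0.
  by rewrite /quad -!lock !scale0r !addr0 !add0r scale1r.
have zy : uz * uy = quad 0 0 0 0 1 0 0 0 0.
  by rewrite /quad -!lock !scale0r !addr0 !add0r scale1r.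
have xz : ux * uz = quad 0 0 0 (q ^+ 2) 0 0 0 0 0.
  by rewrite mul_xz /quad -!lock !scale0r !addr0 !add0r.
have yz : uy * uz = quad 0 0 0 0 (q ^- 2) 0 0 0 0.
  by rewrite mul_yz /quad -!lock !scale0r !addr0 !add0r.
have xy : ux * uy = quad 0 0 (q ^+ 2) 0 0 0 0 (q * t) (-1).
  rewrite mul_xy /quad -!lock !scale0r !addr0 !add0r raddfN scaleN1r.
  by rewrite addrC [- _ + _]addrC addrA.
have yx : uy * ux = quad 0 0 (q ^- 2) 0 0 0 0 (q^-1 * t) (-1).
  rewrite mul_yx /quad -!lock !scale0r !addr0 !add0r raddfN scaleN1r.
  by rewrite addrC [- _ + _]addrC addrA.
have x1 : ux = quad 0 0 0 0 0 1 0 0 0.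
  by rewrite /quad -!lock !scale0r !addr0 !add0r scale1r.
have y1 : uy = quad 0 0 0 0 0 0 1 0 0.
  by rewrite /quad -!lock !scale0r !addr0 !add0r scale1r.
have z1 : uz = quad 0 0 0 0 0 0 0 1 0.
  by rewrite /quad -!lock !scale0r !addr0 !add0r scale1r.
have o1 : 1 = quad 0 0 0 0 0 0 0 0 1.
  by rewrite /quad -!lock !scale0r !addr0 !add0r scale1r.
have xl : ux * lin a' b' c' d' = quad a' 0 (b' * q ^+ 2) (c' * q ^+ 2) 0 d' 0
    (b' * (q * t)) (- b').
  rewrite /lin -!lock !mulrDr -!scalerAr mulr1 xx xy xz x1 !quadE.
  by congr quad; ring.
have yl : uy * lin a' b' c' d' = quad 0 b' (a' * q ^- 2) 0 (c' * q ^- 2) 0 d'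
    (a' * (q^-1 * t)) (- a').
  rewrite /lin -!lock !mulrDr -!scalerAr mulr1 yy yx yz y1 !quadE.
  by move: (q ^- 2) => q2; congr quad; ring.
have zl : uz * lin a' b' c' d' = quad 0 0 c' a' b' 0 0 d' 0.
  rewrite /lin -!lock !mulrDr -!scalerAr mulr1 zx zy zz z1 !quadE.
  by congr quad; ring.
rewrite {1}/lin -lock !mulrDl -!scalerAl mul1r xl yl zl lin_quad !quadE.
by move: (q ^- 2) => q2; congr quad; ring.
Qed.

Lemma k_lin a b c d : uk * lin a b c d =
  lin (q ^+ 2 * a) (q ^- 2 * b) c d * uk
  + lin (- c) (- c) (- (q * a + q^-1 * b) * (q + q^-1))
      (- (q * a + q^-1 * b) * t).
Proof.
have kx : uk * ux = (q ^+ 2)%:C *: (ux * uk)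
    + lin 0 0 (- (q * (q + q^-1))) (- (q * t)).
  rewrite mul_kx /lin -!lock !scale0r !add0r scalerDr !scalerA -!rmorphM /=.
  by rewrite !raddfN /= !scaleNr opprD.
have ky : uk * uy = (q ^- 2)%:C *: (uy * uk)
    + lin 0 0 (- (q^-1 * (q + q^-1))) (- (q^-1 * t)).
  rewrite mul_ky /lin -!lock !scale0r !add0r scalerDr !scalerA -!rmorphM /=.
  by rewrite !raddfN /= !scaleNr opprD.
have kz : uk * uz = uz * uk + lin (-1) (-1) 0 0.
  by rewrite mul_kz /lin -!lock !scale0r !addr0 !raddfN !scaleN1r addrA.
have k1 : uk * 1 = 1 * uk + lin 0 0 0 0.
  by rewrite /lin -!lock !scale0r !addr0 mulr1 mul1r.
rewrite {1 2}/lin -!lock !mulrDr !mulrDl -!scalerAr -!scalerAl kx ky kz k1 !scalerDr.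
rewrite !linZ !scalerA -!rmorphM /= [q ^+ 2 * a]mulrC [q ^- 2 * b]mulrC.
do 3!rewrite [_ + lin _ _ _ _ + (_ + lin _ _ _ _)]addrACA linD.
by congr (_ + lin _ _ _ _); move: (q^-1) => q1; ring.
Qed.

End Relations.

(** * Identities between the operators T^+_c, T^-_c, A_c and iB *)

Section ShiftOperators.
Variables (R : realType) (q t : R).
Hypothesis q_gt0 : 0 < q.
Local Notation C := (R[i]).
Local Notation U := (Usl2 q t).
Local Open Scope complex_scope.
Local Notation lin := (lin q t).
Local Notation s := (q + q^-1).

(* The operators of the statement are repeated as instances of the locked
   [lin], which keeps rewriting from distributing over their summands. *)
Definition tplus (c : R) : U := lin (q `^ c) (q `^ (- c)) (- s) (- t).
Definition tminus (c : R) : U := lin (- q `^ (- c)) (- q `^ c) (- s) (- t).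
Definition aop (c : R) : U := lin q^-1 (- q) (q `^ c - q `^ (- c)) 0.
Definition omega : U :=
  locked (lin q^-1 (- q) 0 0 + (q - q^-1)%:C *: (uz q t * uk q t)).

Lemma TplusE c : Tplus q t c = tplus c.
Proof.
rewrite /Tplus /tplus /lin -!lock /ux /uy /uz -!lock !scalerA -!(mulrC 'i).
by rewrite !raddfN /= !scaleNr [X in X - _ = _]addrAC.
Qed.

Lemma TminusE c : Tminus q t c = tminus c.
Proof.
rewrite /Tminus /tminus /lin -!lock /ux /uy /uz -!lock !scalerA -!(mulrC 'i).
by rewrite !raddfN /= !mulrN !scaleNr [X in X - _ = _]addrAC.
Qed.

Lemma AopE c : Aop q t c = aop c.
Proof.
rewrite /Aop /aop /lin -!lock /ux /uy /uz -!lock !scalerA -!(mulrC 'i).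
by rewrite raddfN /= !mulrN scaleNr addrAC scale0r addr0.
Qed.

Lemma OmegatE : Omegat q t = omega.
Proof.
rewrite /Omegat /omega /lin /ux /uy /uz /uk -!lock /iBt -!scalerAr !scalerA.
by rewrite !(mulrC 'i) rmorphN !mulNr scaleNr !scale0r !addr0 addrAC.
Qed.

Local Notation Tp := tplus.
Local Notation Tm := tminus.
Local Notation Ac := aop.

Lemma q_neq0 : q != 0. Proof. exact: lt0r_neq0. Qed.

Lemma qpow_gt0 c : 0 < q `^ c. Proof. exact: powR_gt0. Qed.

Lemma qpowD c d : q `^ (c + d) = q `^ c * q `^ d.
Proof. by rewrite powRD // q_neq0 implybT. Qed.

Lemma qpow2 : q `^ 2 = q ^+ 2.
Proof. by rewrite powR_mulrn // ltW. Qed.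

Lemma qpow1 : q `^ 1 = q.
Proof. by rewrite powRr1 // ltW. Qed.

Lemma qpowN c : q `^ (- c) = (q `^ c)^-1. Proof. exact: powRN. Qed.

Let qpowE := (qpowD, qpowN, qpow2, qpow1).

Lemma aop_tplus c : Ac (c + 2) * Tp c = Tp c * Ac c.
Proof.
rewrite /aop /tplus !lin_mul !qpowE.
have := lt0r_neq0 (qpow_gt0 c); move: (q `^ c) => Q Q0.
by have q0 := q_neq0; congr quad; field; rewrite ?q0 ?Q0.
Qed.

Lemma aop_tminus c : Ac (c - 2) * Tm c = Tm c * Ac c.
Proof.
rewrite /aop /tminus !lin_mul !qpowE.
have := lt0r_neq0 (qpow_gt0 c); move: (q `^ c) => Q Q0.
by have q0 := q_neq0; congr quad; field; rewrite ?q0 ?Q0.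
Qed.

(** The product is a polynomial in [Ac c] alone, hence a scalar on its eigenvectors. The power [P]
    sits at the midpoint [c + 1] of the two weights involved. *)
Lemma tminus_tplus c (P := q `^ (c + 1)) :
  Tm (c + 2) * Tp c = (-1)%:C *: (Ac c * Ac c)
    + ((- (t * (P - P^-1)))%:C *: Ac c + (t ^+ 2 + (P + P^-1) ^+ 2)%:C *: 1).
Proof.
have -> : (1 : U) = lin 0 0 0 1.
  by rewrite /lin -lock !scale0r !add0r scale1r.
rewrite {}/P /aop /tplus /tminus !lin_mul !linZ !lin_quad !quadZ !quadD.
rewrite !qpowE.
have := lt0r_neq0 (qpow_gt0 c); move: (q `^ c) => Q Q0.
by have q0 := q_neq0; congr quad; field; rewrite ?q0 ?Q0.
Qed.

Lemma tplus_tminus c (P := q `^ (c - 1)) :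
  Tp (c - 2) * Tm c = (-1)%:C *: (Ac c * Ac c)
    + ((- (t * (P - P^-1)))%:C *: Ac c + (t ^+ 2 + (P + P^-1) ^+ 2)%:C *: 1).
Proof.
have -> : (1 : U) = lin 0 0 0 1.
  by rewrite /lin -lock !scale0r !add0r scale1r.
rewrite {}/P /aop /tplus /tminus !lin_mul !linZ !lin_quad !quadZ !quadD.
rewrite !qpowE.
have := lt0r_neq0 (qpow_gt0 c); move: (q `^ c) => Q Q0.
by have q0 := q_neq0; congr quad; field; rewrite ?q0 ?Q0.
Qed.

Hypothesis q_lt1 : q < 1.

Lemma qdiff_neq0 : 1 - q ^+ 2 != 0.
Proof. by rewrite subr_eq0 eq_sym lt_eqF // exprn_ilt1 ?ltW. Qed.

(** On a vector with [uk]-eigenvalue [c] the two terms in [Tp (c + 2)] cancel, which leaves [c+2] as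
    the eigenvalue of the shifted vector. *)
Lemma k_tplus c : uk q t * Tp c =
  Tp (c + 2) * uk q t
  + ((qbrack q (c + 2))%:C *: Tp c + (- qbrack q c)%:C *: Tp (c + 2)).
Proof.
rewrite /tplus k_lin !linZ linD /qbrack !qpowE.
have := lt0r_neq0 (qpow_gt0 c); move: (q `^ c) => Q Q0.
have q0 := q_neq0; have q1 := qdiff_neq0.
by congr (lin _ _ _ _ * _ + lin _ _ _ _); field; rewrite ?mulNr -?expr2 ?q0 ?Q0 ?q1.
Qed.

Lemma k_tminus c : uk q t * Tm c =
  Tm (c - 2) * uk q t
  + ((qbrack q (c - 2))%:C *: Tm c + (- qbrack q c)%:C *: Tm (c - 2)).
Proof.
rewrite /tminus k_lin !linZ linD /qbrack !qpowE.
have := lt0r_neq0 (qpow_gt0 c); move: (q `^ c) => Q Q0.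
have q0 := q_neq0; have q1 := qdiff_neq0.
by congr (lin _ _ _ _ * _ + lin _ _ _ _); field; rewrite ?mulNr -?expr2 ?q0 ?Q0 ?q1.
Qed.

Lemma linN0 d : lin 0 0 0 d = d%:C *: 1.
Proof. by rewrite /lin -lock !scale0r !add0r. Qed.

(** The adjoint of [Tp c] is [Tm c], whereas the product formula involves [Tm (c + 2)]. Applied to
    [Tp c *: v] and paired with a vector v of weight c, only the first term survives, so [r], [g]
    and [m] may stay hidden. *)
Lemma tminus_decomp c : exists r g m : R, Tm c =
  (qbrace q c / qbrace q (c + 2))%:C *: Tm (c + 2)
  + r%:C *: Tp (c + 2) + g%:C *: Ac (c + 2) + m%:C *: 1.
Proof.
pose p := qbrace q c / qbrace q (c + 2).
pose S := q `^ (c + 2).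
(* [g] and [m] are read off the coefficients of [ux] and of 1; those of [uy] and [uz] then determine
   [p] and [r]. *)
pose r := - (s * (q - q^-1) ^+ 2 / ((S + S^-1) * (q * S + (q * S)^-1))).
pose g := q * (- q ^+ 2 / S + p / S - r * S).
pose m := t * (p + r - 1).
exists r, g, m; rewrite -linN0 /tminus /tplus /aop !linZ !linD.
rewrite /m /g /r /p /S /qbrace !qpowE.
have := qpow_gt0 c; move: (q `^ c) => Q Q0.
by congr lin; field; rewrite ?q_neq0 ?lt0r_neq0 //=; nra.
Qed.

(** The previous identity with c replaced by -c and the signs of [ux] and [uy] reversed. This
    exchanges the two shift operators and sends A_{-c} to -A_c, whence the inverse in [S] and the
    sign of [g]. *)
Lemma tplus_decomp c : exists r g m : R, Tp c =
  (qbrace q c / qbrace q (c - 2))%:C *: Tp (c - 2)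
  + r%:C *: Tm (c - 2) + g%:C *: Ac (c - 2) + m%:C *: 1.
Proof.
pose p := qbrace q c / qbrace q (c - 2).
pose S := (q `^ (c - 2))^-1.
pose r := - (s * (q - q^-1) ^+ 2 / ((S + S^-1) * (q * S + (q * S)^-1))).
pose g := - (q * (- q ^+ 2 / S + p / S - r * S)).
pose m := t * (p + r - 1).
exists r, g, m; rewrite -linN0 /tminus /tplus /aop !linZ !linD.
rewrite /m /g /r /p /S /qbrace !qpowE.
have := qpow_gt0 c; move: (q `^ c) => Q Q0.
by congr lin; field; rewrite ?q_neq0 ?lt0r_neq0 //=; nra.
Qed.

(** A 4 by 4 linear system, split by the symmetric part [u] and the antisymmetric part [w] of the
    coefficients of [ux] and [uy]. Its denominators [N] and [G] are positive for every c. *)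
Lemma gens_decomp c (a b d e : R) : exists k l m n : R, lin a b d e =
  k%:C *: Tp c + l%:C *: Tm c + m%:C *: Ac c + n%:C *: 1.
Proof.
pose Q := q `^ c; pose N := Q + Q^-1; pose D := Q - Q^-1.
pose h := (q^-1 - q) / (2 * N); pose G := D ^+ 2 + s ^+ 2.
pose u := (a + b) / 2; pose w := (a - b) / 2.
exists (u / N + w * ((D - 2 * s * h) / G) - d * ((D * h + s / 2) / G)),
  (- u / N + w * ((D + 2 * s * h) / G) + d * ((D * h - s / 2) / G)),
  (w * (2 * s / G) + d * (D / G)),
  (w * (2 * t * D / G) - d * (s * t / G) + e).
rewrite -linN0 /tminus /tplus /aop !linZ !linD.
rewrite /u /w /h /G /D /N /Q !qpowE.
have := qpow_gt0 c; move: (q `^ c) => P P0.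
by congr lin; field; rewrite ?q_neq0 ?lt0r_neq0 //=; nra.
Qed.

Lemma ustarN (x : U) : ustar (- x) = - ustar x.
Proof. by rewrite -scaleN1r ustarZ rmorphN1 scaleN1r. Qed.

Lemma ustar1 : ustar (1 : U) = 1.
Proof. by rewrite -[LHS]mulr1 -{2}[1](@ustarK R q t) -ustarM mulr1 ustarK. Qed.

Lemma conj_real (r : R) : ((r%:C)^*)%R = r%:C.
Proof. exact: conjc_real. Qed.

Lemma ustar_lin a b c d : ustar (lin a b c d) = lin (- b) (- a) c d.
Proof.
rewrite /lin -!lock !ustarD !ustarZ !conj_real ustar_x ustar_y ustar_z ustar1.
by rewrite !raddfN /= !scaleNr [X in X + _ + _ = _]addrC.
Qed.

Lemma ustar_tplus c : ustar (Tp c) = Tm c.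
Proof. by rewrite /tplus /tminus ustar_lin. Qed.

Lemma ustar_tminus c : ustar (Tm c) = Tp c.
Proof. by rewrite -ustar_tplus ustarK. Qed.

(** Formal terms may contain stars, so the induction on terms carries [P] for an element together
    with its adjoint. The adjoints of the generators are again generators up to a scalar. *)
Lemma U_ind (P : U -> Prop) : P (ux q t) -> P (uy q t) -> P (uz q t) ->
  P (uk q t) -> (forall a : C, P (a *: 1)) ->
  (forall u v, P u -> P v -> P (u + v)) ->
  (forall u v, P u -> P v -> P (u * v)) -> forall u, P u.
Proof.
move=> Px Py Pz Pk Pc Pa Pm u; rewrite -[u]ureprK.
have PZ a v : P v -> P (a *: v).
  by move=> Pv; rewrite -[v]mul1r scalerAl; apply: Pm.
have PN v : P v -> P (- v) by rewrite -scaleN1r; apply: PZ.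
have unI (v : U) : v = - ('i : C) *: ('i *: v).
  by rewrite scalerA mulNr -expr2 sqr_i opprK scale1r.
suff /(_ (urepr u)) [] : forall x, P (ucl q t x) /\ P (ustar (ucl q t x)) by [].
elim=> [[]|a|x [h1 h2] y [k1 k2]|x [h1 h2] y [k1 k2]|x [h1 h2]].
- rewrite -/(Xt q t) [Xt q t]unI ustarZ; split; apply: PZ.
    by have := Px; rewrite /ux -lock.
  by have := ustar_x q t; rewrite /ux -lock => ->; apply: PN.
- rewrite -/(Yt q t) [Yt q t]unI ustarZ; split; apply: PZ.
    by have := Py; rewrite /uy -lock.
  by have := ustar_y q t; rewrite /uy -lock => ->; apply: PN.
- have := ustar_z q t; have := Pz.
  by rewrite /uz -!lock /Zt => ? ->.
- rewrite -/(Bt q t) [Bt q t]unI ustarZ; split; apply: PZ.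
    by have := Pk; rewrite /uk -lock.
  by have := ustar_k q t; rewrite /uk -lock /iBt => ->; move: Pk; rewrite /uk -lock.
- by rewrite uclC ustarZ ustar1; split.
- by rewrite uclD ustarD; split; apply: Pa.
- by rewrite uclM ustarM; split; apply: Pm.
- by rewrite ucl_star ustarK.
Qed.

End ShiftOperators.

(** * Monotonicity and injectivity of q-numbers *)

Section QNumberLemmas.
Variables (R : realType) (q : R).
Hypotheses (q_gt0 : 0 < q) (q_lt1 : q < 1).

Lemma ln_q_lt0 : ln q < 0.
Proof. by rewrite ln_lt0 // q_gt0. Qed.

Lemma qpow_ln P : 0 < P -> q `^ (ln P / ln q) = P.
Proof.
move=> P0; rewrite /powR (gt_eqF q_gt0) divfK ?lnK //.
by rewrite lt_eqF // ln_q_lt0.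
Qed.

Lemma qpow_inj : injective (fun x => q `^ x).
Proof.
move=> x y /= /(congr1 (@ln R)); rewrite !ln_powR; apply: mulIf.
by rewrite lt_eqF // ln_q_lt0.
Qed.

Lemma qpow_lt x y : (q `^ x < q `^ y) = (y < x).
Proof.
by rewrite -[LHS]ltr_ln ?posrE ?powR_gt0 // !ln_powR ltr_nM2r // ln_q_lt0.
Qed.

Lemma qdenom_gt0 : 0 < q^-1 - q.
Proof. by rewrite subr_gt0 (lt_trans q_lt1) // invf_gt1. Qed.

Lemma qbrack_inj : injective (qbrack q).
Proof.
move=> x y; rewrite /qbrack => /(mulIf _) h; apply: qpow_inj.
have {h} : q `^ (- x) - q `^ x = q `^ (- y) - q `^ y.
  by apply: h; rewrite invr_eq0 gt_eqF // qdenom_gt0.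
rewrite !powRN; have := powR_gt0 x q_gt0; have := powR_gt0 y q_gt0.
move: (q `^ x) (q `^ y) => P Q Q0 P0 h.
have : (Q - P) * (1 + (P * Q)^-1) = 0.
  rewrite (_ : _ * _ = (P^-1 - P) - (Q^-1 - Q)); first by rewrite h subrr.
  by field; rewrite ?lt0r_neq0.
move/eqP; rewrite mulf_eq0 subr_eq0 [1 + _ == 0]gt_eqF ?orbF; first by move/eqP.
by rewrite addr_gt0 ?invr_gt0 ?mulr_gt0.
Qed.

Lemma qbrack_surj m : exists b, qbrack q b = m.
Proof.
(* With P = q^b the equation [b] = m reads P^2 + d P - 1 = 0, whose positive root is (r - d) / 2. *)
pose d := m * (q^-1 - q); pose r := Num.sqrt (d ^+ 2 + 4).
have r2 : r ^+ 2 = d ^+ 2 + 4 by rewrite sqr_sqrtr // addr_ge0 // sqr_ge0.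
have r0 : 0 <= r by apply: sqrtr_ge0.
have P0 : 0 < (r - d) / 2.
  by rewrite divr_gt0 // subr_gt0 ltNge; apply/negP => rd; nra.
exists (ln ((r - d) / 2) / ln q).
rewrite /qbrack powRN qpow_ln // -[RHS](mulfK (lt0r_neq0 qdenom_gt0)) -/d.
congr (_ / _); apply: (mulfI (lt0r_neq0 P0)); rewrite mulrBr mulfV ?lt0r_neq0 //.
by clear r0 P0; clearbody r d; nra.
Qed.

Lemma qbrace_gt0 x : 0 < qbrace q x.
Proof. by rewrite addr_gt0 ?powR_gt0. Qed.

Lemma qbraceN x : qbrace q (- x) = qbrace q x.
Proof. by rewrite /qbrace opprK addrC. Qed.

Lemma qbrace_norm x : qbrace q `|x| = qbrace q x.
Proof. by have [_|_] := ger0P x; rewrite ?qbraceN. Qed.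

Lemma qbrace_lt x y : (qbrace q x < qbrace q y) = (`|x| < `|y|).
Proof.
have mono u v : 0 <= u -> u < v -> qbrace q u < qbrace q v.
  move=> u0 uv; rewrite /qbrace !powRN.
  have := powR_gt0 v q_gt0; have := qpow_lt v u; rewrite uv.
  have : q `^ u <= 1.
    by rewrite -(powRr0 q) leNgt qpow_lt -leNgt.
  move: (q `^ u) (q `^ v) => P Q P1 QP Q0.
  have P0 : 0 < P by apply: lt_trans QP.
  rewrite -subr_gt0 (_ : _ - _ = (P - Q) * ((P * Q)^-1 - 1)); last first.
    by field; rewrite ?lt0r_neq0.
  rewrite mulr_gt0 ?subr_gt0 // invf_gt1 ?mulr_gt0 //; nra.
rewrite -(qbrace_norm x) -(qbrace_norm y).
have [xy|yx|->] := ltgtP `|x| `|y|; last by rewrite ltxx.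
- by rewrite mono.
- by rewrite ltNge ltW // mono.
Qed.

Lemma qbrace_eq x y : qbrace q x = qbrace q y -> `|x| = `|y|.
Proof.
move=> h; have := qbrace_lt x y; have := qbrace_lt y x.
by rewrite h ltxx; case: ltgtP.
Qed.

Lemma qbrace1 : qbrace q 1 = q^-1 + q.
Proof. by rewrite /qbrace powRN powRr1 ?ltW // addrC. Qed.

End QNumberLemmas.

(** * Complex scalars, linear spans and sesquilinear forms on U-modules *)

Section ScalarAction.
Variables (R : realType) (q t : R).
Local Notation C := (R[i]).
Local Notation U := (Usl2 q t).
Variable V : lmodType U.
Implicit Types (a b : C) (u : U) (v w : V).

Lemma scaler_cscale a u v : (a *: u) *: v = cscale a (u *: v).
Proof. by rewrite /cscale scalerA mulr_algl. Qed.

Lemma cscaleC a u v : u *: cscale a v = cscale a (u *: v).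
Proof. by rewrite -scaler_cscale /cscale scalerA mulr_algr. Qed.

Lemma cscaleDr a v w : cscale a (v + w) = cscale a v + cscale a w.
Proof. exact: scalerDr. Qed.

Lemma cscaleDl a b v : cscale (a + b) v = cscale a v + cscale b v.
Proof. by rewrite /cscale !scalerDl. Qed.

Lemma cscaleA a b v : cscale a (cscale b v) = cscale (a * b) v.
Proof. by rewrite /cscale scalerA mulr_algl scalerA. Qed.

Lemma cscale1 v : cscale 1 v = v.
Proof. by rewrite /cscale !scale1r. Qed.

Lemma cscale0 v : cscale 0 v = 0.
Proof. by rewrite /cscale !scale0r. Qed.

Lemma cscaler0 a : cscale a (0 : V) = 0.
Proof. exact: scaler0. Qed.

Lemma cscaleN1 v : cscale (-1) v = - v.
Proof. by rewrite /cscale !scaleN1r. Qed.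

Lemma cscaleN a v : cscale (- a) v = - cscale a v.
Proof. by rewrite /cscale !scaleNr. Qed.

Lemma cscalerN a v : cscale a (- v) = - cscale a v.
Proof. exact: scalerN. Qed.

Lemma cscale_eq0 a v : a != 0 -> cscale a v = 0 -> v = 0.
Proof.
by move=> a0 h; rewrite -[v]cscale1 -(mulVf a0) -cscaleA h cscaler0.
Qed.

(** An inductive span, so that linear facts about all vectors follow by induction from the spanning
    family. *)
Inductive cspan {I : Type} (e : I -> V) : V -> Prop :=
| cspan_gen i : cspan e (e i)
| cspan0 : cspan e 0
| cspanD v w : cspan e v -> cspan e w -> cspan e (v + w)
| cspanZ a v : cspan e v -> cspan e (cscale a v).

End ScalarAction.

Section Forms.
Variables (R : realType) (q t : R).
Local Notation C := (R[i]).
Local Notation U := (Usl2 q t).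
Variables (V : lmodType U) (f : V -> V -> C).
Hypothesis f_sesq : is_sesquilinear f.
Implicit Types (a b : C) (v w x : V).

Lemma formDr v w x : f v (w + x) = f v w + f v x.
Proof. by have := f_sesq.1 1 v w x; rewrite cscale1 mul1r. Qed.

Lemma formDl v w x : f (v + w) x = f v x + f w x.
Proof. by have := f_sesq.2 1 v w x; rewrite cscale1 rmorph1 mul1r. Qed.

Lemma form0r v : f v 0 = 0.
Proof. by apply: (addrI (f v 0)); rewrite -formDr !addr0. Qed.

Lemma form0l v : f 0 v = 0.
Proof. by apply: (addrI (f 0 v)); rewrite -formDl !addr0. Qed.

Lemma formZr a v w : f v (cscale a w) = a * f v w.
Proof. by have := f_sesq.1 a v w 0; rewrite form0r !addr0. Qed.

Lemma formZl a v w : f (cscale a v) w = (a^*)%R * f v w.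
Proof. by have := f_sesq.2 a v 0 w; rewrite form0l !addr0. Qed.

Lemma formNr v w : f v (- w) = - f v w.
Proof. by rewrite -cscaleN1 formZr mulN1r. Qed.

Lemma formBr v w x : f v (w - x) = f v w - f v x.
Proof. by rewrite formDr formNr. Qed.

Lemma form_sumr (I : Type) (s : seq I) (k : I -> C) (e : I -> V) v :
  f v (\sum_(i <- s) cscale (k i) (e i)) = \sum_(i <- s) k i * f v (e i).
Proof.
elim: s => [|i s IHs]; first by rewrite !big_nil form0r.
by rewrite !big_cons formDr formZr IHs.
Qed.

End Forms.

(** * Weight vectors, their shifts and the norms of the shifts *)

Section WeightVectors.
Variables (R : realType) (q a t lam : R).
Hypotheses (q_gt0 : 0 < q) (q_lt1 : q < 1).
Hypothesis t_def : t = q `^ a - q `^ (- a).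
Local Notation C := (R[i]).
Local Notation U := (Usl2 q t).
Local Notation Tp := (tplus q t).
Local Notation Tm := (tminus q t).
Local Notation Ac := (aop q t).
Local Open Scope complex_scope.

(** The scalar by which going up and coming back acts between the weights m - 1 and m + 1. Indexing
    by the midpoint lets the upward step from m - 1 and the downward step from m + 1 share one
    value. *)
Definition ladder (m : R) : R :=
  (qbrace q (a + m) + lam) * (qbrace q (a - m) - lam).

Section Vectors.
Variable V : lmodType U.
Implicit Types (v w : V) (b c : R).

Definition weight_vector (c : R) (v : V) : Prop :=
  uk q t *: v = cscale (qbrack q c)%:C v /\ Ac c *: v = cscale lam%:C v.

Lemma weight_vectorZ k c v : weight_vector c v -> weight_vector c (cscale k v).
Proof.
by case=> h1 h2; split; rewrite cscaleC ?h1 ?h2 !cscaleA mulrC.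
Qed.

Lemma weight_vector_tplus c v :
  weight_vector c v -> weight_vector (c + 2) (Tp c *: v).
Proof.
case=> hk hA; split; last by rewrite scalerA aop_tplus // -scalerA hA cscaleC.
rewrite scalerA k_tplus // !scalerDl -scalerA hk cscaleC !scaler_cscale.
by rewrite rmorphN cscaleN addrCA subrr addr0.
Qed.

Lemma weight_vector_tminus c v :
  weight_vector c v -> weight_vector (c - 2) (Tm c *: v).
Proof.
case=> hk hA; split; last by rewrite scalerA aop_tminus // -scalerA hA cscaleC.
rewrite scalerA k_tminus // !scalerDl -scalerA hk cscaleC !scaler_cscale.
by rewrite rmorphN cscaleN addrCA subrr addr0.
Qed.

(** The parametrization t = q^a - q^(-a) is what makes the quadratic polynomial in lam split into
    two explicit factors. *)
Lemma ladderE m (P := q `^ m) : ladder m =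
  - (lam * lam) + (- (t * (P - P^-1)) * lam + (t ^+ 2 + (P + P^-1) ^+ 2)).
Proof.
rewrite /ladder /P t_def /qbrace !opprD opprK !(qpowD q_gt0) !qpowN.
have := qpow_gt0 q_gt0 a; have := qpow_gt0 q_gt0 m.
move: (q `^ a) (q `^ m) => X Y X0 Y0.
by field; rewrite ?lt0r_neq0.
Qed.

Lemma tminus_tplus_weight c v : weight_vector c v ->
  Tm (c + 2) *: (Tp c *: v) = cscale (ladder (c + 1))%:C v.
Proof.
case=> _ hA; rewrite scalerA tminus_tplus // !scalerDl !scaler_cscale -scalerA.
rewrite !hA cscaleC hA scale1r !cscaleA -!cscaleDl ladderE.
by congr cscale; rewrite -!rmorphM -!rmorphD /= mulN1r [- lam * _]mulNr.
Qed.

Lemma tplus_tminus_weight c v : weight_vector c v ->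
  Tp (c - 2) *: (Tm c *: v) = cscale (ladder (c - 1))%:C v.
Proof.
case=> _ hA; rewrite scalerA tplus_tminus // !scalerDl !scaler_cscale -scalerA.
rewrite !hA cscaleC hA scale1r !cscaleA -!cscaleDl ladderE.
by congr cscale; rewrite -!rmorphM -!rmorphD /= mulN1r [- lam * _]mulNr.
Qed.

Definition weight b (n : int) : R := b + 2 * n%:~R.

Definition basis_vec b v (n : int) : V :=
  match n with
  | Posz m => Tplus_iter q t b m *: v
  | Negz m => Tminus_iter q t b m.+1 *: v
  end.

Lemma weight0 b : weight b 0 = b.
Proof. by rewrite /weight mulr0 addr0. Qed.

Lemma weightS b n : weight b (n + 1) = weight b n + 2.
Proof. by rewrite /weight intrD; ring. Qed.

Lemma weightB b n : weight b (n - 1) = weight b n - 2.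
Proof. by rewrite /weight intrB; ring. Qed.

Lemma weight_inj b : injective (weight b).
Proof.
move=> m n /addrI /mulfI h; apply/eqP.
by rewrite -(eqr_int R); apply/eqP/h; rewrite pnatr_eq0.
Qed.

Lemma basis_vec0 b v : basis_vec b v 0 = v.
Proof. by rewrite /= scale1r. Qed.

Lemma basis_vecS b v (m : nat) :
  basis_vec b v m.+1%:Z = Tp (weight b m%:Z) *: basis_vec b v m%:Z.
Proof. by rewrite /= -scalerA TplusE. Qed.

Lemma basis_vecB b v (m : nat) :
  basis_vec b v (- m.+1%:Z) = Tm (weight b (- m%:Z)) *: basis_vec b v (- m%:Z).
Proof.
have -> : weight b (- m%:Z) = b - 2 * m%:R.
  by rewrite /weight intrN mulrN.
rewrite -NegzE; case: m => [|m]; first by rewrite /= scale1r mulr1 TminusE.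
by rewrite -NegzE /= -!scalerA !TminusE.
Qed.

Lemma weightSz b (m : nat) : weight b m.+1%:Z = weight b m%:Z + 2.
Proof. by rewrite -weightS -addn1 PoszD. Qed.

Lemma weightBz b (m : nat) : weight b (- m.+1%:Z) = weight b (- m%:Z) - 2.
Proof. by rewrite -weightB -addn1 PoszD opprD. Qed.

Lemma basis_vec_weight b v n :
  weight_vector b v -> weight_vector (weight b n) (basis_vec b v n).
Proof.
move=> hv; elim/int_rect: n => [|n IHn|n IHn].
- by rewrite weight0 basis_vec0.
- by rewrite basis_vecS weightSz; apply: weight_vector_tplus.
- by rewrite basis_vecB weightBz; apply: weight_vector_tminus.
Qed.

(** For n < 0 the vector was itself obtained by T^- from its upper neighbour, so T^+ undoes that
    step up to a ladder value. *)
Lemma tplus_basis_vec b v n : weight_vector b v ->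
  exists k, Tp (weight b n) *: basis_vec b v n = cscale k (basis_vec b v (n + 1)).
Proof.
move=> hv; case: n => [n|[|n]].
- by exists 1; rewrite cscale1 -PoszD addn1 basis_vecS.
- exists (ladder (b - 1))%:C; rewrite -[Negz 0]/(- 1%:Z) addNr basis_vecB.
  rewrite weightBz !oppr0 weight0 tplus_tminus_weight basis_vec0 //.
- have -> : Negz n.+1 + 1 = - n.+1%:Z by lia.
  rewrite NegzE basis_vecB weightBz.
  exists (ladder (weight b (- n.+1%:Z) - 1))%:C.
  by rewrite tplus_tminus_weight //; apply: basis_vec_weight.
Qed.

Lemma tminus_basis_vec b v n : weight_vector b v ->
  exists k, Tm (weight b n) *: basis_vec b v n = cscale k (basis_vec b v (n - 1)).
Proof.
move=> hv; case: n => [[|n]|n].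
- by exists 1; rewrite cscale1 -[0%Z - 1]/(- 1%:Z) basis_vecB oppr0.
- have -> : n.+1%:Z - 1 = n by lia.
  exists (ladder (weight b n%:Z + 1))%:C.
  rewrite basis_vecS weightSz tminus_tplus_weight //.
  exact: basis_vec_weight.
- have -> : Negz n - 1 = - n.+2%:Z by lia.
  by exists 1; rewrite cscale1 NegzE [RHS]basis_vecB.
Qed.

Lemma cspan_act (I : Type) (e : I -> V) (u : U) v :
  (forall i, cspan e (u *: e i)) -> cspan e v -> cspan e (u *: v).
Proof.
move=> h; elim=> [i||x y _ hx _ hy|k x _ hx]; first exact: h.
- by rewrite scaler0; apply: cspan0.
- by rewrite scalerDr; apply: cspanD.
- by rewrite cscaleC; apply: cspanZ.
Qed.

Lemma basis_vec_cspan b v (u : U) : weight_vector b v ->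
  cspan (basis_vec b v) (u *: v).
Proof.
(* The claim is generalized to all basis vectors, which the case of a product of two elements
   requires. *)
move=> hv; rewrite -{2}(basis_vec0 b v); move: (0 : int).
have hlin k l m d n : cspan (basis_vec b v) (lin q t k l m d *: basis_vec b v n).
  have [kp [km [ka [k1 ->]]]] := gens_decomp t q_gt0 (weight b n) k l m d.
  rewrite !scalerDl !scaler_cscale.
  have [? ->] := tplus_basis_vec n hv; have [? ->] := tminus_basis_vec n hv.
  have [_ ->] := basis_vec_weight n hv; rewrite scale1r.
  by do !apply: cspanD; do ?apply: cspanZ; apply: cspan_gen.
have lin1 : [/\ lin q t 1 0 0 0 = ux q t, lin q t 0 1 0 0 = uy q t,
    lin q t 0 0 1 0 = uz q t & lin q t 0 0 0 1 = 1].
  by rewrite /lin -!lock !scale0r !scale1r !addr0 !add0r.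
case: lin1 => lx ly lz l1.
elim/U_ind: u => [|||| k|u u' hu hu'|u u' hu hu'] n.
- by rewrite -lx; apply: hlin.
- by rewrite -ly; apply: hlin.
- by rewrite -lz; apply: hlin.
- have [-> _] := basis_vec_weight n hv.
  by apply: cspanZ; apply: cspan_gen.
- by rewrite scaler_cscale scale1r; apply: cspanZ; apply: cspan_gen.
- by rewrite scalerDl; apply: cspanD.
- by rewrite -scalerA; apply: cspan_act.
Qed.

Lemma cyclic_cspan b v w : weight_vector b v -> is_cyclic v ->
  cspan (basis_vec b v) w.
Proof. by move=> hv hc; have [u ->] := hc w; apply: basis_vec_cspan. Qed.

(** (q - q^-1) [c] = q^c - q^(-c), so the term of Omega containing iB becomes the [uz] term of
    A_c. *)
Lemma Omega_weight c v : uk q t *: v = cscale (qbrack q c)%:C v ->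
  omega q t *: v = Ac c *: v.
Proof.
move=> hk; rewrite /omega /aop -lock.
have -> : lin q t q^-1 (- q) (q `^ c - q `^ (- c)) 0 =
    lin q t q^-1 (- q) 0 0 + (q `^ c - q `^ (- c))%:C *: uz q t.
  by rewrite /lin -!lock !scale0r !addr0.
rewrite !scalerDl; congr (_ + _).
rewrite !scaler_cscale -scalerA hk cscaleC cscaleA; congr cscale.
rewrite -rmorphM /qbrack; congr (_%:C); field.
by rewrite mulNr -expr2 (qdiff_neq0 q_gt0 q_lt1) lt0r_neq0.
Qed.

Lemma Omega_cyclic b v w : weight_vector b v -> is_cyclic v ->
  omega q t *: w = cscale lam%:C w.
Proof.
move=> hv hc; elim: (cyclic_cspan w hv hc) => [n||x y _ hx _ hy|k x _ hx].
- have [hk hA] := basis_vec_weight n hv.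
  by rewrite (Omega_weight hk).
- by rewrite scaler0 cscaler0.
- by rewrite scalerDr cscaleDr hx hy.
- by rewrite cscaleC hx !cscaleA mulrC.
Qed.

Section InvariantForm.
Variable f : V -> V -> C.
Hypotheses (f_sesq : is_sesquilinear f) (f_inv : is_invariant f).

Lemma eigen_orth c d v w : uk q t *: v = cscale (qbrack q c)%:C v ->
  uk q t *: w = cscale (qbrack q d)%:C w -> c <> d -> f v w = 0.
Proof.
move=> hv hw cd; have := f_inv (uk q t) v w.
rewrite ustar_k hv hw (formZr f_sesq) (formZl f_sesq) conj_real.
move=> /eqP; rewrite -subr_eq0 -mulrBl mulf_eq0 -rmorphB => /orP[|/eqP//].
rewrite fmorph_eq0 subr_eq0 => /eqP /(qbrack_inj q_gt0 q_lt1) dc.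
by case: cd.
Qed.

Lemma weight_orth c d v w :
  weight_vector c v -> weight_vector d w -> c <> d -> f v w = 0.
Proof. by move=> [hv _] [hw _]; apply: eigen_orth. Qed.

Lemma norm_tplus c v : weight_vector c v ->
  f (Tp c *: v) (Tp c *: v) =
  (qbrace q c / qbrace q (c + 2) * ladder (c + 1))%:C * f v v.
Proof.
move=> hv; rewrite -[in LHS]ustar_tminus -f_inv ustar_tminus.
have h1 := weight_vector_tplus hv; have h2 := weight_vector_tplus h1.
have [r [g [m ->]]] := tminus_decomp t q_gt0 c.
rewrite !scalerDl !scaler_cscale tminus_tplus_weight // scale1r.
rewrite !(formDr f_sesq) !(formZr f_sesq) h1.2 !(formZr f_sesq).
have ne x : 0 < x -> c <> c + x by move=> x0 /eqP; lra.
rewrite (weight_orth hv h2) ?(weight_orth hv h1) ?mulr0 ?addr0.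
- by rewrite mulrA -rmorphM.
- by apply: ne; rewrite ltr0n.
- by rewrite -addrA; apply: ne; rewrite addr_gt0 ?ltr0n.
Qed.

Lemma norm_tminus c v : weight_vector c v ->
  f (Tm c *: v) (Tm c *: v) =
  (qbrace q c / qbrace q (c - 2) * ladder (c - 1))%:C * f v v.
Proof.
move=> hv; rewrite -[in LHS]ustar_tplus -f_inv ustar_tplus.
have h1 := weight_vector_tminus hv; have h2 := weight_vector_tminus h1.
have [r [g [m ->]]] := tplus_decomp t q_gt0 c.
rewrite !scalerDl !scaler_cscale tplus_tminus_weight // scale1r.
rewrite !(formDr f_sesq) !(formZr f_sesq) h1.2 !(formZr f_sesq).
have ne x : 0 < x -> c <> c - x by move=> x0 /eqP; lra.
rewrite (weight_orth hv h2) ?(weight_orth hv h1) ?mulr0 ?addr0.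
- by rewrite mulrA -rmorphM.
- by apply: ne; rewrite ltr0n.
- by rewrite -addrA -opprD; apply: ne; rewrite addr_gt0 ?ltr0n.
Qed.

Lemma basis_vec_orth b v m n : weight_vector b v -> m <> n ->
  f (basis_vec b v m) (basis_vec b v n) = 0.
Proof.
move=> hv mn; apply: weight_orth (basis_vec_weight m hv)
  (basis_vec_weight n hv) _.
by move/weight_inj.
Qed.

End InvariantForm.
End Vectors.
End WeightVectors.

(** * Spanning orthogonal families with positive norms *)

Section OrthogonalBasis.
Variables (R : realType) (q t : R).
Local Notation C := (R[i]).
Local Notation U := (Usl2 q t).
Variables (V : lmodType U) (f : V -> V -> C) (I : eqType) (e : I -> V).
Hypothesis f_sesq : is_sesquilinear f.
Hypothesis e_orth : forall i j, i <> j -> f (e i) (e j) = 0.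
Hypothesis e_pos : forall i, 0 < f (e i) (e i).
Hypothesis e_span : forall v, cspan e v.

Let e_neq0 i : f (e i) (e i) != 0. Proof. exact: lt0r_neq0. Qed.

Let ocoef v i := f (e i) v / f (e i) (e i).

(** Allowing every index list that contains [s0] lets the expansions of two vectors be added over a
    common list. *)
Lemma orthogonal_expansion v : exists s0 : seq I, forall s, uniq s ->
  {subset s0 <= s} -> v = \sum_(i <- s) cscale (ocoef v i) (e i).
Proof.
elim: (e_span v) => [j||x y _ [s1 h1] _ [s2 h2]|k x _ [s0 h]].
- exists [:: j] => s us sj; rewrite (bigD1_seq j) //=; last first.
    by apply: sj; rewrite inE.
  rewrite big1_seq; first by rewrite /ocoef divff // cscale1 addr0.
  move=> i /andP[/eqP ij _].
  by rewrite /ocoef e_orth // mul0r cscale0.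
- exists [::] => s _ _; rewrite big1 // => i _.
  by rewrite /ocoef (form0r f_sesq) mul0r cscale0.
- exists (s1 ++ s2) => s us ss.
  have /(h1 s us) e1 : {subset s1 <= s}.
    by move=> i hi; apply: ss; rewrite mem_cat hi.
  have /(h2 s us) e2 : {subset s2 <= s}.
    by move=> i hi; apply: ss; rewrite mem_cat hi orbT.
  rewrite {1}e1 {1}e2.
  rewrite -big_split; apply: eq_bigr => i _ /=.
  by rewrite -cscaleDl /ocoef (formDr f_sesq) mulrDl.
- exists s0 => s us ss; rewrite {1}(h s us ss).
  elim: s {us ss} => [|i s IHs]; first by rewrite !big_nil cscaler0.
  by rewrite !big_cons cscaleDr IHs cscaleA /ocoef (formZr f_sesq) mulrA.
Qed.

Lemma orthogonal_is_basis : is_basis e.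
Proof.
split=> [v|s k us hs j js].
  have [s0 h] := orthogonal_expansion v.
  exists (undup s0), (ocoef v); apply: h; first exact: undup_uniq.
  by move=> i; rewrite mem_undup.
have : f (e j) (\sum_(i <- s) cscale (k i) (e i)) = 0 by rewrite hs (form0r f_sesq).
rewrite (form_sumr f_sesq) (bigD1_seq j) //= big1 => [|i /eqP ij].
  by rewrite addr0 => /eqP; rewrite mulf_eq0 (negPf (e_neq0 j)) orbF => /eqP.
by rewrite e_orth ?mulr0 // => ji; apply: ij.
Qed.

(** Hermitian symmetry is derived here: it holds on the orthogonal family because its norms are
    real. *)
Lemma orthogonal_hermitian v i : f v (e i) = ((f (e i) v)^*)%R.
Proof.
elim: (e_span v) => [j||x y _ hx _ hy|k x _ hx].
- have [->|/eqP ij] := eqVneq i j; first by rewrite conj_Creal // gtr0_real.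
  by rewrite !e_orth ?rmorph0 // => ji; apply: ij.
- by rewrite (form0l f_sesq) (form0r f_sesq) rmorph0.
- by rewrite (formDl f_sesq) (formDr f_sesq) rmorphD hx hy.
- by rewrite (formZl f_sesq) (formZr f_sesq) rmorphM hx.
Qed.

Lemma orthogonal_posdef : is_posdef f.
Proof.
move=> v v0; have [s0 hs] := orthogonal_expansion v.
have h : v = \sum_(i <- undup s0) cscale (ocoef v i) (e i).
  by apply: hs (undup_uniq _) _ => i; rewrite mem_undup.
have fvv : f v v = \sum_(i <- undup s0) `|f (e i) v| ^+ 2 / f (e i) (e i).
  rewrite [in X in f v X]h (form_sumr f_sesq); apply: eq_bigr => i _.
  by rewrite orthogonal_hermitian normCK /ocoef mulrAC.
have ge0 i : 0 <= `|f (e i) v| ^+ 2 / f (e i) (e i).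
  by rewrite divr_ge0 ?exprn_ge0 // ltW.
rewrite lt_def fvv sumr_ge0 // andbT; apply: contra v0.
rewrite psumr_eq0 // => /allP z0; rewrite h big1_seq // => i /andP[_ /z0 /=].
rewrite mulf_eq0 invr_eq0 (negPf (e_neq0 i)) orbF expf_eq0 normr_eq0 /=.
by move=> /eqP fi; rewrite /ocoef fi mul0r cscale0.
Qed.

End OrthogonalBasis.

(** * The coefficient of a cyclic weight vector *)

Section WeightCoefficient.
Variables (R : realType) (q a t lam : R).
Hypotheses (q_gt0 : 0 < q) (q_lt1 : q < 1).
Hypothesis t_def : t = q `^ a - q `^ (- a).
Local Notation C := (R[i]).
Local Notation U := (Usl2 q t).
Local Notation uk := (uk q t).
Local Open Scope complex_scope.
Variables (V : lmodType U) (b : R) (v0 : V).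
Hypothesis v0_weight : weight_vector lam b v0.
Hypothesis v0_cyclic : is_cyclic v0.
Hypothesis v0_neq0 : v0 != 0.
Local Notation beta := ((qbrack q b)%:C : C).

(** This is the projection of w to the eigenspace of [b] along the other eigenspaces, phrased so
    that the remaining basis vectors may vanish or be unknown. *)
Definition is_coef (k : C) (w : V) : Prop := exists p : {poly C},
  p.[beta] != 0 /\ horner_alg uk p *: (w - cscale k v0) = 0.

Lemma horner_uk_v0 (p : {poly C}) :
  horner_alg uk p *: v0 = cscale p.[beta] v0.
Proof.
elim/poly_ind: p => [|p c IHp]; first by rewrite rmorph0 scale0r horner0 cscale0.
rewrite rmorphD rmorphM /= horner_algX horner_algC !hornerE scalerDl.
rewrite -scalerA v0_weight.1 cscaleC IHp cscaleA scaler_cscale scale1r.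
by rewrite -cscaleDl mulrC.
Qed.

Lemma horner_ukC (p r : {poly C}) (w : V) :
  horner_alg uk (p * r) *: w = horner_alg uk r *: (horner_alg uk p *: w).
Proof. by rewrite mulrC rmorphM scalerA. Qed.

(** The product of the two polynomials kills (k - l) v0 but acts on v0 by a nonzero scalar. *)
Lemma is_coef_uniq k l w : is_coef k w -> is_coef l w -> k = l.
Proof.
move=> [p [p0 hp]] [r [r0 hr]]; apply/eqP; rewrite -subr_eq0; apply/negPn/negP.
move=> kl; case/eqP: v0_neq0.
apply: (@cscale_eq0 _ _ _ _ ((p * r).[beta] * (k - l))).
  by rewrite hornerM !mulf_neq0.
rewrite mulrC -cscaleA -horner_uk_v0 -cscaleC.
have -> : cscale (k - l) v0 = (w - cscale l v0) - (w - cscale k v0).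
  by rewrite opprB [RHS]addrC addrA subrK cscaleDl cscaleN.
by rewrite scalerBr {1}[p * r]mulrC !horner_ukC hp hr !scaler0 subrr.
Qed.

Lemma is_coefD k l v w : is_coef k v -> is_coef l w -> is_coef (k + l) (v + w).
Proof.
move=> [p [p0 hp]] [r [r0 hr]]; exists (p * r); split.
  by rewrite hornerM mulf_neq0.
rewrite cscaleDl opprD addrACA scalerDr {2}[p * r]mulrC !horner_ukC hp hr.
by rewrite !scaler0 addr0.
Qed.

Lemma is_coefZ k l v : is_coef k v -> is_coef (l * k) (cscale l v).
Proof.
move=> [p [p0 hp]]; exists p; split=> //.
by rewrite -cscaleA -cscalerN -cscaleDr cscaleC hp cscaler0.
Qed.

Lemma is_coef0 : is_coef 0 0.
Proof.
by exists 1; rewrite hornerC oner_neq0 cscale0 subr0 scaler0.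
Qed.

Lemma is_coef_uk k v : is_coef k v -> is_coef (beta * k) (uk *: v).
Proof.
move=> [p [p0 hp]]; exists p; split=> //.
have -> : uk *: v - cscale (beta * k) v0 = uk *: (v - cscale k v0).
  by rewrite scalerBr cscaleC v0_weight.1 cscaleA mulrC.
have cX : horner_alg uk p * horner_alg uk 'X = horner_alg uk 'X * horner_alg uk p.
  by rewrite -!rmorphM mulrC.
by rewrite horner_algX in cX; rewrite scalerA cX -scalerA hp scaler0.
Qed.

Lemma is_coef_ex w : exists k, is_coef k w.
Proof.
elim: (cyclic_cspan q_gt0 q_lt1 t_def w v0_weight v0_cyclic) =>
  [n||x y _ [k hk] _ [l hl]|k x _ [l hl]].
- have [-> |n0] := eqVneq n 0.
    exists 1, 1; rewrite hornerC oner_neq0 basis_vec0 cscale1 subrr scaler0.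
    by split.
  (* A basis vector with n <> 0 is killed by iB - [b+2n], and [b+2n] differs from [b]. *)
  exists 0, ('X - ((qbrack q (weight b n))%:C)%:P); split.
    rewrite !hornerE subr_eq0; apply: contra n0 => /eqP /complexI.
    move/(qbrack_inj q_gt0 q_lt1); rewrite -{1}(weight0 b).
    by move/weight_inj => <-.
  have [hk _] := basis_vec_weight q_gt0 q_lt1 n v0_weight.
  rewrite cscale0 subr0 rmorphB /= horner_algX horner_algC scalerBl.
  by rewrite hk scaler_cscale scale1r subrr.
- by exists 0; apply: is_coef0.
- by exists (k + l); apply: is_coefD.
- by exists (k * l); apply: is_coefZ.
Qed.

Definition weight_coef (w : V) : C := xget 0 [set k | is_coef k w]%classic.

Lemma weight_coefP w : is_coef (weight_coef w) w.
Proof.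
exact: (@xgetPex _ 0 [set k | is_coef k w]%classic (is_coef_ex w)).
Qed.

Lemma weight_coefE k w : is_coef k w -> weight_coef w = k.
Proof. exact/is_coef_uniq/weight_coefP. Qed.

Lemma weight_coefD v w : weight_coef (v + w) = weight_coef v + weight_coef w.
Proof. by apply: weight_coefE; apply: is_coefD; apply: weight_coefP. Qed.

Lemma weight_coefZ k v : weight_coef (cscale k v) = k * weight_coef v.
Proof. by apply: weight_coefE; apply: is_coefZ; apply: weight_coefP. Qed.

Lemma weight_coef_uk v : weight_coef (uk *: v) = beta * weight_coef v.
Proof. by apply: weight_coefE; apply: is_coef_uk; apply: weight_coefP. Qed.

Lemma weight_coef_v0 : weight_coef v0 = 1.
Proof.
apply: weight_coefE; exists 1.
by rewrite hornerC oner_neq0 cscale1 subrr scaler0.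
Qed.

End WeightCoefficient.

(** * The invariant form on a cyclic module with known annihilator *)

Section CyclicForm.
Variables (R : realType) (q a t lam b : R).
Hypotheses (q_gt0 : 0 < q) (q_lt1 : q < 1).
Hypothesis t_def : t = q `^ a - q `^ (- a).
Local Notation C := (R[i]).
Local Notation U := (Usl2 q t).
Local Open Scope complex_scope.
Local Notation beta := ((qbrack q b)%:C : C).

Lemma ustar_omega : ustar (omega q t) = omega q t.
Proof.
rewrite /omega -!lock ustarD ustarZ ustarM ustar_k ustar_z ustar_lin conj_real opprK.
rewrite mul_kz.
have -> : uz q t * uk q t - ux q t - uy q t =
    uz q t * uk q t + lin q t (-1) (-1) 0 0.
  by rewrite /lin -lock !scale0r !addr0 !raddfN !scaleN1r addrA.
rewrite scalerDr linZ addrCA linD addrC.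
by congr (lin _ _ _ _ _ _ + _); ring.
Qed.

(** This gives access to the adjoint of A_b - lam: Omega and iB - [b] are both self-adjoint, and
    Omega acts everywhere by lam. *)
Lemma aop_omega : aop q t b =
  omega q t - (q - q^-1)%:C *: (uz q t * (uk q t - beta *: 1)).
Proof.
rewrite /omega -lock mulrBr mulr_algr scalerBr opprB -[RHS]addrA.
rewrite [X in _ = _ + X]addrC subrK scalerA /aop.
have -> : lin q t q^-1 (- q) (q `^ b - q `^ (- b)) 0 =
    lin q t q^-1 (- q) 0 0 + (q `^ b - q `^ (- b))%:C *: uz q t.
  by rewrite /lin -!lock !scale0r !addr0.
congr (_ + _ *: _); rewrite -rmorphM /qbrack; congr (_%:C); field.
by rewrite mulNr -expr2 (qdiff_neq0 q_gt0 q_lt1) lt0r_neq0.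
Qed.

(* The annihilator of [v0] is generated by [uk - [b]] and [aop b - lam]. *)
Definition standard_annihilator (V : lmodType U) (v0 : V) : Prop :=
  forall P : U -> Prop, P 0 ->
  (forall u v, P u -> P v -> P (u + v)) -> (forall u v, P v -> P (u * v)) ->
  P (uk q t - beta *: 1) -> P (aop q t b - lam%:C *: 1) ->
  forall u, u *: v0 = 0 -> P u.

Variables (V : lmodType U) (v0 : V).
Hypothesis v0_weight : weight_vector lam b v0.
Hypothesis v0_cyclic : is_cyclic v0.
Hypothesis v0_neq0 : v0 != 0.
Hypothesis v0_annih : standard_annihilator v0.

Local Notation coef := (weight_coef b v0).
Let coefD := weight_coefD q_gt0 q_lt1 t_def v0_weight v0_cyclic v0_neq0.
Let coefZ := weight_coefZ q_gt0 q_lt1 t_def v0_weight v0_cyclic v0_neq0.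
Let coef_uk := weight_coef_uk q_gt0 q_lt1 t_def v0_weight v0_cyclic v0_neq0.

Let coef0 : coef 0 = 0.
Proof. by rewrite -(cscale0 (0 : V)) coefZ mul0r. Qed.

(** This makes the form well defined in its first variable. The coefficient vanishes on the images
    of iB - [b] and of Omega - lam, and the adjoint of each generator of the annihilator is a
    combination of these two, multiplied on the right. *)
Lemma coef_ustar_annih u : u *: v0 = 0 -> forall w, coef (ustar u *: w) = 0.
Proof.
have coefN w : coef (- w) = - coef w by rewrite -cscaleN1 coefZ mulN1r.
have kill w : coef ((uk q t - beta *: 1) *: w) = 0.
  rewrite scalerBl coefD coefN coef_uk scaler_cscale scale1r coefZ.
  by rewrite subrr.
have kill_star : ustar (uk q t - beta *: 1) = uk q t - beta *: 1.
  by rewrite ustarD ustarN ustarZ ustar_k ustar1 conj_real.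
move: u; apply: v0_annih.
- by move=> w; rewrite -(scale0r (0 : U)) ustarZ rmorph0 !scale0r coef0.
- by move=> u v hu hv w; rewrite ustarD scalerDl coefD hu hv addr0.
- by move=> u v hv w; rewrite ustarM -scalerA hv.
- by move=> w; rewrite kill_star kill.
- move=> w; rewrite aop_omega ustarD [ustar (_ - _)]ustarD ustar_omega !ustarN.
  rewrite !ustarZ ustarM kill_star ustar1 !conj_real !scalerDl !scaleNr.
  rewrite (Omega_cyclic q_gt0 q_lt1 t_def w v0_weight v0_cyclic).
  rewrite !scaler_cscale scale1r -scalerA addrAC subrr sub0r coefN coefZ kill.
  by rewrite mulr0 oppr0.
Qed.


(* The form sends [u v0, w] to the [v0]-coefficient of [u^* w]. *)
Lemma invariant_form_ex : exists f : V -> V -> C,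
  [/\ is_sesquilinear f, is_invariant f & f v0 v0 = 1].
Proof.
pose lift v := sval (cid (v0_cyclic v)).
have liftK v : lift v *: v0 = v by rewrite /lift; case: cid.
pose f v w := coef (ustar (lift v) *: w).
have fE u v w : u *: v0 = v -> f v w = coef (ustar u *: w).
  move=> uv; have := @coef_ustar_annih (u - lift v) _ w.
  rewrite scalerBl uv liftK subrr ustarD ustarN scalerBl coefD.
  rewrite -cscaleN1 coefZ mulN1r => /(_ erefl) /eqP.
  by rewrite subr_eq0 => /eqP ->.
exists f; split.
- split=> c x y z.
    by rewrite /f scalerDr cscaleC coefD coefZ.
  rewrite (fE (c *: lift x + lift y)); last first.
    by rewrite scalerDl scaler_cscale !liftK.
  by rewrite ustarD ustarZ scalerDl coefD scaler_cscale coefZ.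
- move=> u v w; rewrite [RHS](fE (ustar u * lift v)); last by rewrite -scalerA liftK.
  by rewrite ustarM ustarK /f -scalerA.
- rewrite (fE 1) ?scale1r // ustar1 scale1r.

  exact (weight_coef_v0 q_gt0 q_lt1 t_def v0_weight v0_cyclic v0_neq0).
Qed.

End CyclicForm.

(** * The annihilator of the generator of M and its universal property *)

Section InducedModule.
Variables (R : realType) (q a t lam b : R).
Hypotheses (q_gt0 : 0 < q) (q_lt1 : q < 1).
Hypothesis t_def : t = q `^ a - q `^ (- a).
Local Notation C := (R[i]).
Local Notation U := (Usl2 q t).
Local Notation M := (M_mod q t lam b).
Local Open Scope complex_scope.
Local Notation beta := ((qbrack q b)%:C : C).
Local Notation one := (M_one q t lam b).

Lemma Bt_uk : Bt q t - (- ('i * beta)) *: 1 = - ('i : C) *: (uk q t - beta *: 1).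
Proof.
rewrite /uk -lock /iBt scalerBr !scalerA !mulNr -expr2 sqr_i opprK scale1r //.
Qed.

Lemma scale_ind_class (u v : U) : u *: ind_class b v = ind_class b (u * v).
Proof. by rewrite [LHS](esym (@qclass_scalable _ _ _ u (v : U^o))). Qed.

Lemma scale_M_class (u v : U) :
  u *: (qclass (@I_ideal _ q t lam b) (ind_class b v) : M) =
  qclass (@I_ideal _ q t lam b) (ind_class b (u * v)).
Proof. by rewrite -linearZ scale_ind_class. Qed.

Lemma scale_M_one (u : U) :
  u *: one = qclass (@I_ideal _ q t lam b) (ind_class b u).
Proof. by rewrite scale_M_class mulr1. Qed.

Lemma M_one_annih : standard_annihilator lam b one.
Proof.
move=> P P0 PD PM Pk PA u.
have PS (v w : U) : P w -> P (v - w) -> P v.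
  by move=> h1 h2; rewrite -[v](subrK w) addrC; apply: PD.
have Pind v : in_span (@ind_relations _ q t b) v -> P v.
  elim=> {v} [v [w [p ->]]||v w _ hv _ hw|c v _ hv] //; last 2 first.
  - exact: PD.
  - exact: PM.
  have -> : w * horner_alg (Bt q t) p - p.[- ('i * beta)] *: w =
      w * horner_alg (Bt q t) (p - (p.[- ('i * beta)])%:P).
    by rewrite rmorphB /= horner_algC mulrBr mulr_algr.
  (* Each inducing relation comes from a polynomial in B vanishing at -i[b], hence is a left
     multiple of B + i[b], which is -i (iB - [b]). *)
  have /factor_theorem [r ->] : root (p - (p.[- ('i * beta)])%:P) (- ('i * beta)).
    by rewrite /root !hornerE subrr.
  rewrite rmorphM rmorphB /= horner_algX horner_algC Bt_uk.
  apply: (PM); apply: (PM); rewrite -[X in P X]mulr_algl.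
  exact: PM.
have Pcl v v' : ind_class b v = ind_class b v' -> P v' -> P v.
  by move=> /eqP /qclassP /Pind hv hv'; apply: PS hv' hv.
rewrite scale_M_one -(raddf0 (qclass (@I_ideal _ q t lam b))) => /eqP /qclassP.
rewrite subr0.
have Pspan w : in_span (@I_ideal _ q t lam b) w ->
    exists2 v, w = ind_class b v & P v.
  elim=> {w} [w [v _ ->]||v w _ [v' -> hv] _ [w' -> hw]|c v _ [v' -> hv]].
  - by exists (v * (Aop q t b - lam%:C *: 1)) => //; rewrite AopE; apply: PM.
  - by exists 0 => //; rewrite /ind_class raddf0.
  - by exists (v' + w'); [rewrite /ind_class raddfD | apply: PD].
  - by exists (c * v'); [rewrite -scale_ind_class | apply: PM].
by case/Pspan => v /Pcl h /h.
Qed.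

Lemma M_one_weight : weight_vector lam b one.
Proof.
split.
- apply/eqP; rewrite -subr_eq0 /cscale -scalerBl.
  have -> : uk q t - beta *: 1 = ('i *: 1) * (Bt q t - (- ('i * beta)) *: 1).
    by rewrite Bt_uk mulr_algl scalerA mulrN -expr2 sqr_i opprK scale1r.
  rewrite -scalerA scale_M_one (_ : ind_class b _ = 0).
    by rewrite raddf0 scaler0.
  apply/eqP; rewrite /ind_class -(raddf0 (qclass (@ind_relations _ q t b))).
  apply/qclassP; rewrite subr0; apply: span_gen; exists 1, 'X.
  by rewrite mul1r horner_algX hornerX.
- apply/eqP; rewrite -subr_eq0 /cscale -scalerBl scale_M_one.
  rewrite -(raddf0 (qclass (@I_ideal _ q t lam b))).
  apply/qclassP; rewrite subr0; apply: span_gen; exists 1; first exact: Um_1.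
  by rewrite mul1r AopE.
Qed.

Lemma M_one_cyclic : is_cyclic one.
Proof.
by move=> w; exists (qrepr (qrepr w)); rewrite scale_M_one /ind_class !qreprK.
Qed.

(** M maps to any module with a vector of weight b and central value lam, the generator going to
    that vector. *)
Lemma M_one_universal (V : lmodType U) (v : V) (u : U) :
  weight_vector lam b v -> u *: one = 0 -> u *: v = 0.
Proof.
move=> [hk hA]; move: u; apply: M_one_annih.
- exact: scale0r.
- by move=> u w hu hw; rewrite scalerDl hu hw addr0.
- by move=> u w hw; rewrite -scalerA hw scaler0.
- by rewrite scalerBl hk scaler_cscale scale1r subrr.
- by rewrite scalerBl hA scaler_cscale scale1r subrr.
Qed.

Lemma M_vecE n : M_vec q t lam b n = basis_vec b one n.
Proof. by []. Qed.

Hypothesis one_neq0 : one != 0.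

Lemma M_formP : is_canonical_form (@M_form R q t lam b).
Proof.
apply: (@xgetPex _ _ [set f | @is_canonical_form R q t lam b f]%classic).
have [f [f1 f2 f3]] := invariant_form_ex q_gt0 q_lt1 t_def M_one_weight
  M_one_cyclic one_neq0 M_one_annih.
by exists f; split; rewrite // M_vecE basis_vec0.
Qed.

End InducedModule.

(** * A module of sequences showing that the generator of M is nonzero *)

Section Model.
Variables (R : realType) (q a t lam b : R).
Hypotheses (q_gt0 : 0 < q) (q_lt1 : q < 1).
Hypothesis t_def : t = q `^ a - q `^ (- a).
Local Notation C := (R[i]).
Local Notation U := (Usl2 q t).
Local Notation W := (nat -> C).
Local Open Scope complex_scope.
Local Notation I := ('i : C).

Let Q : C := q%:C.
Let A : C := (q `^ a)%:C.
Let T : C := t%:C.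
Let L : C := lam%:C.
Let D : C := (q `^ b - q `^ (- b))%:C.

Let Q_neq0 : Q != 0. Proof. by rewrite fmorph_eq0 lt0r_neq0. Qed.
Let A_neq0 : A != 0. Proof. by rewrite fmorph_eq0 lt0r_neq0 ?qpow_gt0. Qed.
Let T_def : T = A - A^-1.
Proof. by rewrite /T t_def rmorphB powRN fmorphV. Qed.
Let Q2_neq1 : Q ^+ 2 - 1 != 0.
Proof.
have -> : Q ^+ 2 - 1 = (q ^+ 2 - 1)%:C by rewrite rmorphB rmorphXn rmorph1.
by rewrite fmorph_eq0 -opprB oppr_eq0 qdiff_neq0.
Qed.

Let P (n : nat) : C := (Q ^+ 2) ^+ n.
Let P0 : P 0 = 1. Proof. by []. Qed.
Let PS n : P n.+1 = Q ^+ 2 * P n. Proof. exact: exprS. Qed.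
Let P_neq0 n : P n != 0. Proof. by rewrite !expf_neq0. Qed.

(* [z] acts diagonally with eigenvalues [q^(1-a+2n)], [x] is the shift, and
   [k] is then forced by [Omega = lam]. *)
Let zeta n : C := Q * P n / A.
(** The relation for [uy * ux] forces [be n] = -1 + q^-1 t [zeta n] + q^-2 ([zeta n])^2. Starting
    [zeta] at q^(1-a) makes [be 0] vanish, so the truncated predecessor in [sy] and [sk] does no
    harm. *)
Let be n : C := - (1 - P n) * (1 + P n / A ^+ 2).

Let sx (f : W) : W := fun n => f n.+1.
Let sy (f : W) : W := fun n => be n * f n.-1.
Let sz (f : W) : W := fun n => zeta n * f n.
Let sk (f : W) : W := fun n =>
  (L * f n - Q^-1 * f n.+1 + Q * (be n * f n.-1)) / (zeta n * (Q - Q^-1)).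

Ltac model_field n := case: n => [|n]; rewrite /sx /sy /sz /sk /zeta /be /= ?T_def
  ?PS ?P0; first (by field; rewrite ?mulNr -?expr2 ?Q_neq0 ?A_neq0 ?Q2_neq1);
  by field; rewrite ?mulNr -?expr2 ?Q_neq0 ?A_neq0 ?Q2_neq1 ?P_neq0.

Lemma model_xz f n : sx (sz f) n = Q ^+ 2 * sz (sx f) n.
Proof. model_field n. Qed.

Lemma model_yz f n : sy (sz f) n = Q ^- 2 * sz (sy f) n.
Proof. model_field n. Qed.

Lemma model_xy f n :
  sx (sy f) n = - f n + Q * T * sz f n + Q ^+ 2 * sz (sz f) n.
Proof. model_field n. Qed.

Lemma model_yx f n :
  sy (sx f) n = - f n + Q^-1 * T * sz f n + Q ^- 2 * sz (sz f) n.
Proof. model_field n. Qed.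

Lemma model_kz f n : sk (sz f) n = sz (sk f) n - sx f n - sy f n.
Proof. model_field n. Qed.

Lemma model_kx f n :
  sk (sx f) n = Q ^+ 2 * sx (sk f) n - Q * ((Q + Q^-1) * sz f n + T * f n).
Proof. model_field n. Qed.

Lemma model_ky f n :
  sk (sy f) n = Q ^- 2 * sy (sk f) n - Q^-1 * ((Q + Q^-1) * sz f n + T * f n).
Proof. model_field n. Qed.

Let scales (s : W -> W) := forall c f, s (fun n => c * f n) = (fun n => c * s f n).

Let sxZ : scales sx. Proof. by []. Qed.
Let syZ : scales sy.
Proof. by move=> c f; apply/funext => n; rewrite /sy mulrCA. Qed.
Let szZ : scales sz.
Proof. by move=> c f; apply/funext => n; rewrite /sz mulrCA. Qed.
Let skZ : scales sk.
Proof.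
by move=> c f; apply/funext => n; rewrite /sk; ring.
Qed.

(* [op s x] is the action of [x], or of its adjoint when [s] holds. *)
Fixpoint model_op (s : bool) (x : uterm R) : W -> W :=
  match x with
  | TGen GX => fun f n => - I * (if s then sy f n else sx f n)
  | TGen GY => fun f n => - I * (if s then sx f n else sy f n)
  | TGen GZ => sz
  | TGen GB => fun f n => (if s then I else - I) * sk f n
  | TCst c => fun f n => (if s then (c^*)%R else c) * f n
  | TAdd x y => fun f n => model_op s x f n + model_op s y f n
  | TMul x y => fun f =>
      if s then model_op s y (model_op s x f) else model_op s x (model_op s y f)
  | TStar x => model_op (~~ s) x
  end.

Lemma model_op_linear s x c f g : model_op s x (fun n => c * f n + g n) =
  fun n => c * model_op s x f n + model_op s x g n.
Proof.
elim: x s f g => [[]|d|x IHx y IHy|x IHx y IHy|x IHx] s f g //=.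
- by apply/funext => n; case: s; rewrite ?/sx ?/sy; ring.
- by apply/funext => n; case: s; rewrite ?/sx ?/sy; ring.
- by apply/funext => n; rewrite /sz; ring.
- by apply/funext => n; rewrite /sk; ring.
- by apply/funext => n; ring.
- by apply/funext => n; rewrite IHx IHy; ring.
- by case: s; rewrite ?IHx ?IHy ?IHx.
Qed.

Let opD s x f g :
  model_op s x (fun n => f n + g n) = fun n => model_op s x f n + model_op s x g n.
Proof.
have := model_op_linear s x 1 f g.
have -> : (fun n => 1 * f n + g n) = (fun n => f n + g n).
  by apply/funext => n; rewrite mul1r.
by move=> ->; apply/funext => n; rewrite mul1r.
Qed.

Let opZ s x c f : model_op s x (fun n => c * f n) = fun n => c * model_op s x f n.
Proof.
have op0 : model_op s x (fun=> 0) = fun=> 0.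
  have := opD s x (fun=> 0) (fun=> 0).
  have -> : (fun n : nat => 0 + 0) = (fun=> 0) :> W by apply/funext => n; rewrite addr0.
  move=> /(congr1 (fun h => h _)) h; apply/funext => n; move: (h n).
  by rewrite -[LHS]addr0 => /addrI <-.
have := model_op_linear s x c f (fun=> 0).
have -> : (fun n => c * f n + 0) = (fun n => c * f n).
  by apply/funext => n; rewrite addr0.
by move=> ->; apply/funext => n; rewrite op0 addr0.
Qed.

Let II v : - I * (- I * v) = - v.
Proof. by rewrite mulrA mulrNN -expr2 sqr_i mulN1r. Qed.

Let II' v : I * (- I * v) = v.
Proof. by rewrite mulrA mulrN -expr2 sqr_i opprK mul1r. Qed.

Let II'' v : - I * (I * v) = v.
Proof. by rewrite mulrA mulNr -expr2 sqr_i opprK mul1r. Qed.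

Let conj_n1 : ((-1 : C)^*)%R = -1. Proof. by rewrite rmorphN1. Qed.

Lemma model_op_rel s x y : urel q t x y -> model_op s x = model_op s y.
Proof.
case; apply/funext => f; apply/funext => n; case: s => /=;
  rewrite ?conj_real ?conj_n1 ?rmorph1 ?sxZ ?syZ ?szZ ?skZ ?II ?II' ?II''.
all: rewrite ?rmorphD ?rmorphM ?rmorphXn ?fmorphV /= -/Q -/T.
all: rewrite ?model_xz ?model_yz ?model_xy ?model_yx ?model_kz ?model_kx ?model_ky.
all: try by (field; rewrite ?Q_neq0).
all: rewrite ?sxZ ?syZ ?model_xz ?model_yz ?rmorphXn -/Q.
all: by field; rewrite ?Q_neq0.
Qed.

(** Both values of [s] are treated at once, since passing under a star exchanges them. *)
Lemma model_op_ueq x y : ueq q t x y -> forall s, model_op s x = model_op s y.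
Proof.
have fext (f g : W -> W) : (forall h n, f h n = g h n) -> f = g.
  by move=> h; apply/funext => k; apply/funext => n; apply: h.
elim=> {x y}.
- by move=> x y h s; apply: model_op_rel.
- by [].
- by move=> x y _ h s; rewrite h.
- by move=> x y z _ h1 _ h2 s; rewrite h1 h2.
- by move=> x x' y y' _ h1 _ h2 s /=; rewrite h1 h2.
- by move=> x x' y y' _ h1 _ h2 s /=; rewrite h1 h2.
- by move=> x x' _ h s /=; rewrite h.
- by move=> x y z s; apply: fext => f n /=; rewrite addrA.
- by move=> x y s; apply: fext => f n /=; rewrite addrC.
- by move=> x s; apply: fext => f n /=; rewrite rmorph0 if_same mul0r add0r.
- move=> x s; apply: fext => f n /=; rewrite rmorphN1 rmorph0 !if_same mul0r.
  by case: s; rewrite ?opZ mulN1r addNr.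
- by move=> x y z s /=; case: s.
- move=> x s; apply: fext => f n /=; rewrite rmorph1 !if_same.
  by case: s; rewrite ?opZ mul1r.
- by move=> x y z s; apply: fext => f n /=; case: s; rewrite ?opD.
- by move=> x y z s; apply: fext => f n /=; case: s; rewrite ?opD.
- by move=> c d s; apply: fext => f n /=; case: s; rewrite ?rmorphD mulrDl.
- move=> c d s; apply: fext => f n /=; case: s; rewrite ?rmorphM mulrA //.
  by rewrite [(c^*)%R * _]mulrC.
- by move=> c x s; apply: fext => f n /=; case: s; rewrite ?opZ.
- by [].
- by move=> x y s; apply: fext => f n /=; case: s.
- by move=> x s; rewrite /= negbK.
- by move=> c s; apply: fext => f n /=; case: s; rewrite //= conjCK.
Qed.

Definition model_act (u : U) : W -> W := model_op false (urepr u).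

Lemma model_act_ucl x : model_act (ucl q t x) = model_op false x.
Proof. exact/model_op_ueq/urepr_ucl. Qed.

Lemma model_actD u v f n : model_act (u + v) f n = model_act u f n + model_act v f n.
Proof. by rewrite -[u]ureprK -[v]ureprK -uclD !model_act_ucl. Qed.

Lemma model_actM u v f : model_act (u * v) f = model_act u (model_act v f).
Proof. by rewrite -[u]ureprK -[v]ureprK -uclM !model_act_ucl. Qed.

Lemma model_actZ c u f n : model_act (c *: u) f n = c * model_act u f n.
Proof. by rewrite -[u]ureprK -uclZ !model_act_ucl. Qed.

Lemma model_act1 f : model_act 1 f = f.
Proof.
have -> : 1 = ucl q t (TCst 1) by rewrite uclC scale1r.
by rewrite model_act_ucl; apply/funext => n; rewrite /= mul1r.
Qed.

Lemma model_act_zero u : model_act u (fun=> 0) = fun=> 0.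
Proof.
have := opZ false (urepr u) 0 (fun=> 0).
have -> : (fun n : nat => 0 * 0) = (fun=> 0) :> W by apply/funext => n; rewrite mul0r.
by rewrite /model_act => ->; apply/funext => n; rewrite mul0r.
Qed.

Lemma model_act_lin c1 c2 c3 c4 f n : model_act (lin q t c1 c2 c3 c4) f n =
  c1%:C * sx f n + c2%:C * sy f n + c3%:C * sz f n + c4%:C * f n.
Proof.
rewrite /lin /ux /uy /uz -!lock !model_actD !model_actZ model_act1.
by rewrite !model_act_ucl /= !II'.
Qed.

Lemma model_act_k f n : model_act (uk q t) f n = sk f n.
Proof. by rewrite /uk -lock /iBt model_actZ model_act_ucl /= II'. Qed.

(** The equation A_b w = lam w is a three-term recurrence, and the pair holds two consecutive
    entries of its solution with w_0 = 1. The initial 0 stands for the entry before w_0, which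
    [be 0] = 0 multiplies. Sequences of arbitrary support are allowed, so the recurrence always has
    a solution. *)
Fixpoint model_pair (n : nat) : C * C :=
  if n is m.+1 then
    let: (u, v) := model_pair m in
    (v, Q * ((L - D * zeta m) * v + Q * (be m * u)))
  else (0, 1).

Let w n := (model_pair n).2.

Lemma model_wS n : w n.+1 = Q * ((L - D * zeta n) * w n + Q * (be n * w n.-1)).
Proof.
rewrite /w; case: n => [|n] /=; first by rewrite /be P0 subrr oppr0 !mul0r.
by case: (model_pair n).
Qed.

(** The sequence [w] is killed by both generators of the annihilator of [e_b]. If [e_b] were zero, 1
    would annihilate it and hence kill [w], whose first entry is 1. *)
Lemma M_one_neq0 : M_one q t lam b != 0.
Proof.
apply/eqP => one0.
suff : model_act 1 w = fun=> 0.
  by rewrite model_act1 => /(congr1 (fun f => f 0%N)) /eqP; rewrite oner_eq0.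
have one_ann : (1 : U) *: M_one q t lam b = 0 by rewrite one0 scaler0.
have D_k : (Q - Q^-1) * (qbrack q b)%:C = D.
  rewrite /Q /D -fmorphV -rmorphB -rmorphM /qbrack; congr (_%:C); field.
  by rewrite mulNr -expr2 qdiff_neq0 // lt0r_neq0.
have QQ : Q - Q^-1 != 0.
  rewrite (_ : Q - Q^-1 = (Q ^+ 2 - 1) / Q) ?mulf_neq0 ?invr_eq0 //.
  by field.
have zeta_neq0 n : zeta n != 0 by rewrite !mulf_neq0 ?invr_eq0 ?P_neq0.
apply: (M_one_annih (P := fun u => model_act u w = fun=> 0)) one_ann.
- by apply/funext => n; rewrite -(scale0r (0 : U)) model_actZ mul0r.
- by move=> u v hu hv; apply/funext => n; rewrite model_actD hu hv addr0.
- by move=> u v hv; rewrite model_actM hv model_act_zero.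
- apply/funext => n; rewrite model_actD -scaleNr model_actZ model_act1.
  rewrite model_act_k /sk model_wS -D_k.
  by field; rewrite ?Q_neq0 ?zeta_neq0 // -expr2 Q2_neq1.
- apply/funext => n; rewrite model_actD -scaleNr model_actZ model_act1.
  rewrite /aop model_act_lin -/D /sx /sy /sz model_wS rmorphN fmorphV -/Q -/L.
  by field.
Qed.

End Model.

(** The form in which linear arithmetic over the reals can use that n is an integer. *)
Lemma int_cases (R : realType) (n : int) :
  [\/ n%:~R = 0 :> R, n%:~R <= -1 :> R | 1 <= n%:~R :> R].
Proof.
have [n0|n0|->] := ltgtP n 0; last by constructor 1.
- by constructor 2; rewrite -[-1]/((-1)%:~R) ler_int; lia.
- by constructor 3; rewrite -[1]/(1%:~R) ler_int; lia.
Qed.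

(** * Signs and zeros of the ladder products in the four series *)

Section LadderSigns.
Variables (R : realType) (q a lam : R).
Hypotheses (q_gt0 : 0 < q) (q_lt1 : q < 1).
Implicit Types (b m x y : R).
Local Notation ladder := (ladder q a lam).

Lemma qbrace_le x y : (qbrace q x <= qbrace q y) = (`|x| <= `|y|).
Proof. by rewrite leNgt qbrace_lt // -leNgt. Qed.

(** A number in [-1, 1] has least absolute value in its class modulo 2. The windows for b and b' put
    a - b - 1 and a + b' + 1 there, so the two bounds on lam control the whole ladder. *)
Lemma qbrace_min x (n : int) : -1 <= x <= 1 ->
  qbrace q x <= qbrace q (x + 2 * n%:~R).
Proof.
move=> /andP[x1 x2]; rewrite qbrace_le; move: (n%:~R) (int_cases R n) => z hz.
case: (ger0P x) => h1; case: (ger0P (x + _)) => h2; case: hz; lra.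
Qed.

(** The two factors cannot both be negative: that would make lam smaller than a negative number and
    larger than a positive one. *)
Lemma ladder_gt0 m :
  (0 < ladder m) = (- qbrace q (a + m) < lam < qbrace q (a - m)).
Proof.
rewrite /ladder; have := qbrace_gt0 q_gt0 (a + m); have := qbrace_gt0 q_gt0 (a - m).
move: (qbrace q _) (qbrace q _) => y x x0 y0.
apply/idP/andP => [h|[h1 h2]]; last by apply: mulr_gt0; lra.
have [h1|h1] := lerP (y + lam) 0.
  by move: h; rewrite ltNge mulr_le0_ge0 //; lra.
by split; [lra | rewrite -subr_gt0 -(pmulr_rgt0 _ h1)].
Qed.

Lemma ladder_eq0 m :
  ladder m = 0 <-> lam = - qbrace q (a + m) \/ lam = qbrace q (a - m).
Proof.
rewrite /ladder; split=> [/eqP|[->|->]]; rewrite ?addrN ?mul0r ?subrr ?mulr0 //.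
rewrite mulf_eq0 addr_eq0 subr_eq0 => /orP[]/eqP h; [left | by right].
by rewrite h opprK.
Qed.

Lemma principal_ladder b (n : int) :
  principal_series q a lam b -> 0 < ladder (weight b n + 1).
Proof.
move=> [/andP[b1 b2] [b' [/andP[b3 b4] [k bk] /andP[l1 l2]]]].
rewrite ladder_gt0; apply/andP; split.
- apply: le_lt_trans l1; rewrite lerN2.
  have -> : a + (weight b n + 1) = a + b' + 1 + 2 * (n - k)%:~R.
    by rewrite /weight intrB; lra.
  by apply: qbrace_min; apply/andP; split; lra.
- apply: lt_le_trans l2 _.
  have -> : a - (weight b n + 1) = a - b - 1 + 2 * (- n)%:~R.
    by rewrite /weight intrN; lra.
  by apply: qbrace_min; apply/andP; split; lra.
Qed.

Lemma lowest_ladder0 b : lowest_weight_series q a lam b -> ladder (b - 1) = 0.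
Proof.
move=> h; apply/ladder_eq0; case: h => [[_ ->]|[_ ->]]; [left | right].
  by congr (- qbrace q _); ring.
by congr (qbrace q _); ring.
Qed.

Lemma lowest_ladder b (n : nat) : lowest_weight_series q a lam b ->
  0 < ladder (weight b n%:Z + 1).
Proof.
move=> h; rewrite ladder_gt0 /weight -pmulrn; have := ler0n R n.
move: (n%:R) => z z0; have B := qbrace_gt0 q_gt0.
case: h => [[h ->]|[h ->]]; apply/andP; split.
- rewrite ltrN2 qbrace_lt //.
  case: (ger0P (a + b - 1)) => h1; case: (ger0P (a + _)) => h2; lra.
- by apply: lt_trans (B _); rewrite oppr_lt0.
- by apply: lt_trans (B _); rewrite oppr_lt0.
- rewrite qbrace_lt //.
  case: (ger0P (a - b + 1)) => h1; case: (ger0P (a - _)) => h2; lra.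
Qed.

Lemma highest_ladder0 b : highest_weight_series q a lam b -> ladder (b + 1) = 0.
Proof.
move=> h; apply/ladder_eq0; case: h => [[_ ->]|[_ ->]]; [left | right].
  by congr (- qbrace q _); ring.
by congr (qbrace q _); ring.
Qed.

Lemma highest_ladder b (n : nat) : highest_weight_series q a lam b ->
  0 < ladder (weight b (- n%:Z) - 1).
Proof.
move=> h; rewrite ladder_gt0 /weight intrN -pmulrn; have := ler0n R n.
move: (n%:R) => z z0; have B := qbrace_gt0 q_gt0.
case: h => [[h ->]|[h ->]]; apply/andP; split.
- rewrite ltrN2 qbrace_lt //.
  case: (ger0P (a + b + 1)) => h1; case: (ger0P (a + (_ + _))) => h2; lra.
- by apply: lt_trans (B _); rewrite oppr_lt0.
- by apply: lt_trans (B _); rewrite oppr_lt0.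
- rewrite qbrace_lt //.
  case: (ger0P (a - b - 1)) => h1; case: (ger0P (a - (_ + _))) => h2; lra.
Qed.

Lemma characters_ladder0 b : characters q a lam b ->
  ladder (b - 1) = 0 /\ ladder (b + 1) = 0.
Proof.
rewrite /characters -qbrace1 //.
move=> h; split; apply/ladder_eq0; case: h => [[-> ->]|[-> ->]].
- by left; rewrite -(qbraceN q 1); congr (- qbrace q _); ring.
- by right; congr (qbrace q _); ring.
- by left; congr (- qbrace q _); ring.
- by right; rewrite -(qbraceN q 1); congr (qbrace q _); ring.
Qed.

End LadderSigns.

(** * The quotient L, its form and its basis *)

Section LModule.
Variables (R : realType) (q a t lam b : R).
Hypotheses (q_gt0 : 0 < q) (q_lt1 : q < 1).
Hypothesis t_def : t = q `^ a - q `^ (- a).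
Local Notation C := (R[i]).
Local Notation U := (Usl2 q t).
Local Notation M := (M_mod q t lam b).
Local Notation L := (L_mod q t lam b).
Local Notation mone := (M_one q t lam b).
Local Notation mform := (@M_form R q t lam b).
Local Notation lform := (L_form q t lam b).
Local Notation ladder := (ladder q a lam).
Local Open Scope complex_scope.

Definition L_class : M -> L := qclass (@N_kernel _ q t lam b).
Local Notation one := (L_class mone).

Let M_form_can : is_canonical_form mform.
Proof. exact: M_formP q_gt0 q_lt1 t_def (M_one_neq0 lam b q_gt0 q_lt1 t_def). Qed.
Let mform_sesq : is_sesquilinear mform. Proof. by case: M_form_can. Qed.
Let mform_inv : is_invariant mform. Proof. by case: M_form_can. Qed.
Let mform1 : mform mone mone = 1.
Proof. by case: M_form_can; rewrite M_vecE basis_vec0. Qed.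

Section BasisNorms.
Variables (V : lmodType U) (f : V -> V -> C) (v0 : V).
Hypotheses (f_sesq : is_sesquilinear f) (f_inv : is_invariant f).
Hypotheses (v0_weight : weight_vector lam b v0) (v0_norm : f v0 v0 = 1).
Local Notation e := (basis_vec b v0).
Local Notation wt := (weight b).

Let ratio (x y : R) : R := qbrace q x / qbrace q y.
Let ratio_gt0 x y : 0 < ratio x y.
Proof. by rewrite divr_gt0 ?qbrace_gt0. Qed.

Lemma basis_normS (n : nat) : f (e n.+1%:Z) (e n.+1%:Z) =
  (ratio (wt n%:Z) (wt n%:Z + 2) * ladder (wt n%:Z + 1))%:C * f (e n%:Z) (e n%:Z).
Proof.
have h := basis_vec_weight q_gt0 q_lt1 n v0_weight.
by rewrite basis_vecS (norm_tplus q_gt0 q_lt1 t_def f_sesq f_inv h).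
Qed.

Lemma basis_normB (n : nat) : f (e (- n.+1%:Z)) (e (- n.+1%:Z)) =
  (ratio (wt (- n%:Z)) (wt (- n%:Z) - 2) * ladder (wt (- n%:Z) - 1))%:C
  * f (e (- n%:Z)) (e (- n%:Z)).
Proof.
have h := basis_vec_weight q_gt0 q_lt1 (- n%:Z) v0_weight.
by rewrite basis_vecB (norm_tminus q_gt0 q_lt1 t_def f_sesq f_inv h).
Qed.

Lemma basis_norm_real n : f (e n) (e n) \is Num.real.
Proof.
elim/int_rect: n => [|n IHn|n IHn].
- by rewrite basis_vec0 v0_norm real1.
- by rewrite basis_normS realM // complex_real.
- by rewrite basis_normB realM // complex_real.
Qed.

Lemma basis_normS_gt0 (n : nat) : 0 < f (e n%:Z) (e n%:Z) ->
  0 < ladder (wt n%:Z + 1) -> 0 < f (e n.+1%:Z) (e n.+1%:Z).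
Proof.
by move=> h l; rewrite basis_normS mulr_gt0 // ltcR mulr_gt0 // ratio_gt0.
Qed.

Lemma basis_normB_gt0 (n : nat) : 0 < f (e (- n%:Z)) (e (- n%:Z)) ->
  0 < ladder (wt (- n%:Z) - 1) -> 0 < f (e (- n.+1%:Z)) (e (- n.+1%:Z)).
Proof.
by move=> h l; rewrite basis_normB mulr_gt0 // ltcR mulr_gt0 // ratio_gt0.
Qed.

End BasisNorms.

Let mone_weight : weight_vector lam b mone := M_one_weight q t lam b.

(** The kernel is defined through the first variable, while the form on L takes representatives in
    both; symmetry transfers the independence to the second variable. It holds because the norms of
    the [e_c] are obtained from 1 by real factors. *)
Lemma M_form_hermitian v w : mform w v = ((mform v w)^*)%R.
Proof.
have mspan x := cyclic_cspan q_gt0 q_lt1 t_def x mone_weight (@M_one_cyclic R q t lam b).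
elim: (mspan v) => [m||x y _ hx _ hy|k x _ hx].
- elim: (mspan w) => [n||x y _ hx _ hy|k x _ hx].
  + have [->|/eqP mn] := eqVneq n m.
      by rewrite conj_Creal //; apply: basis_norm_real.
    rewrite !(basis_vec_orth q_gt0 q_lt1 mform_sesq mform_inv mone_weight) //.
      by rewrite rmorph0.
    by move=> nm; apply: mn.
  + by rewrite (form0l mform_sesq) (form0r mform_sesq) rmorph0.
  + by rewrite (formDl mform_sesq) (formDr mform_sesq) rmorphD hx hy.
  + by rewrite (formZl mform_sesq) (formZr mform_sesq) rmorphM hx.
- by rewrite (form0l mform_sesq) (form0r mform_sesq) rmorph0.
- by rewrite (formDl mform_sesq) (formDr mform_sesq) rmorphD hx hy.
- by rewrite (formZl mform_sesq) (formZr mform_sesq) rmorphM /= conjCK hx.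
Qed.

Lemma N_kernel_span v : in_span (@N_kernel _ q t lam b) v ->
  forall w, mform v w = 0.
Proof.
elim=> {v} [v|w|v w _ hv _ hw x|u v _ hv w] //; first exact: form0l.
- by rewrite (formDl mform_sesq) hv hw addr0.
- by rewrite -[u]ustarK -mform_inv hv.
Qed.

Lemma L_formE v w : lform (L_class v) (L_class w) = mform v w.
Proof.
have rep x : in_span (@N_kernel _ q t lam b) (qrepr (L_class x) - x).
  by apply/qclassP; rewrite qreprK.
have eql x y : mform (qrepr (L_class x)) y = mform x y.
  have := N_kernel_span (rep x) y; rewrite (formDl mform_sesq) -cscaleN1.
  by rewrite (formZl mform_sesq) rmorphN1 mulN1r => /eqP; rewrite subr_eq0 => /eqP.
by rewrite /L_form eql M_form_hermitian eql -M_form_hermitian.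
Qed.

Lemma L_class_surj (v : L) : exists w, v = L_class w.
Proof. by exists (qrepr v); rewrite /L_class qreprK. Qed.

Lemma L_classZ (u : U) v : u *: L_class v = L_class (u *: v).
Proof. by rewrite /L_class linearZ. Qed.

Lemma L_classcZ (k : C) v : cscale k (L_class v) = L_class (cscale k v).
Proof. exact: L_classZ. Qed.

Lemma L_classD v w : L_class v + L_class w = L_class (v + w).
Proof. by rewrite /L_class raddfD. Qed.

Lemma L_form_sesquilinear : is_sesquilinear lform.
Proof.
split=> k x y z; have [x' ->] := L_class_surj x; have [y' ->] := L_class_surj y;
  have [z' ->] := L_class_surj z; rewrite L_classcZ L_classD !L_formE.
  by rewrite (formDr mform_sesq) (formZr mform_sesq).
by rewrite (formDl mform_sesq) (formZl mform_sesq).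
Qed.

Lemma L_form_invariant : is_invariant lform.
Proof.
move=> u v w; have [v' ->] := L_class_surj v; have [w' ->] := L_class_surj w.
by rewrite !L_classZ !L_formE mform_inv.
Qed.

Lemma L_form_nondegenerate v : (forall w, lform v w = 0) -> v = 0.
Proof.
have [v' -> h] := L_class_surj v; apply/eqP.
rewrite -(raddf0 (qclass (@N_kernel _ q t lam b))); apply/qclassP; rewrite subr0.
by apply: span_gen => w; rewrite -L_formE h.
Qed.

Lemma L_one_weight : weight_vector lam b one.
Proof.
have [h1 h2] := mone_weight.
by split; rewrite L_classZ L_classcZ ?h1 ?h2.
Qed.

Lemma L_one_cyclic : is_cyclic one.
Proof.
move=> v; have [w ->] := L_class_surj v.
by have [u ->] := @M_one_cyclic R q t lam b w; exists u; rewrite L_classZ.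
Qed.

Lemma L_one_norm : lform one one = 1. Proof. by rewrite L_formE. Qed.

Lemma L_vecE n : L_vec q t lam b n = basis_vec b one n.
Proof. by rewrite /L_vec M_vecE; case: n => n; rewrite /= L_classZ. Qed.

Local Notation e := (basis_vec b one).
Local Notation wt := (weight b).

Lemma L_span v : cspan e v.
Proof. exact: (cyclic_cspan q_gt0 q_lt1 t_def _ L_one_weight L_one_cyclic). Qed.

Lemma L_orth m n : m <> n -> lform (e m) (e n) = 0.
Proof.
exact: (basis_vec_orth q_gt0 q_lt1 L_form_sesquilinear L_form_invariant L_one_weight).
Qed.

(** Such a vector is orthogonal to all the other [e_c] as well, hence to everything, and the form on
    L is nondegenerate. *)
Lemma L_vec_eq0 n : lform (e n) (e n) = 0 -> e n = 0.
Proof.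
move=> n0; apply: L_form_nondegenerate => w.
elim: (L_span w) => [m||x y _ hx _ hy|k x _ hx].
- by have [<-//|/eqP mn] := eqVneq n m; rewrite L_orth.
- exact: form0r L_form_sesquilinear _.
- by rewrite (formDr L_form_sesquilinear) hx hy addr0.
- by rewrite (formZr L_form_sesquilinear) hx mulr0.
Qed.

Let norm0 : 0 < lform (e 0) (e 0).
Proof. by rewrite basis_vec0 L_one_norm ltr01. Qed.

Let pos_up : (forall n : nat, 0 < ladder (wt n%:Z + 1)) ->
  forall n : nat, 0 < lform (e n%:Z) (e n%:Z).
Proof.
move=> h; elim=> [|n IHn]; first exact: norm0.
exact: (basis_normS_gt0 L_form_sesquilinear L_form_invariant L_one_weight).
Qed.

Let pos_down : (forall n : nat, 0 < ladder (wt (- n%:Z) - 1)) ->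
  forall n : nat, 0 < lform (e (- n%:Z)) (e (- n%:Z)).
Proof.
move=> h; elim=> [|n IHn]; first by rewrite oppr0; exact: norm0.
exact: (basis_normB_gt0 L_form_sesquilinear L_form_invariant L_one_weight).
Qed.

Let zero_up : ladder (b + 1) = 0 -> forall n : nat, e n.+1%:Z = 0.
Proof.
move=> h; elim=> [|n IHn]; last by rewrite basis_vecS IHn scaler0.
apply: L_vec_eq0; rewrite (basis_normS L_form_sesquilinear L_form_invariant L_one_weight).
by rewrite weight0 h mulr0 mul0r.
Qed.

Let zero_down : ladder (b - 1) = 0 -> forall n : nat, e (- n.+1%:Z) = 0.
Proof.
move=> h; elim=> [|n IHn]; last by rewrite basis_vecB IHn scaler0.
apply: L_vec_eq0; rewrite (basis_normB L_form_sesquilinear L_form_invariant L_one_weight).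
by rewrite oppr0 weight0 h mulr0 mul0r.
Qed.

Definition in_range (s : series) (n : int) : bool :=
  match s with
  | Principal => true
  | LowestWeight => 0 <= n
  | HighestWeight => n <= 0
  | Character => n == 0
  end.

Lemma L_norm_gt0 s n : in_series q a s lam b -> in_range s n ->
  0 < lform (e n) (e n).
Proof.
case: s => /= hs.
- move=> _; case: n => [n|n]; first by apply: pos_up => m; apply: principal_ladder.
  rewrite NegzE; apply: pos_down => m.
  (* The downward step from a weight and the upward step from the weight below it have the same
     midpoint. *)
  have -> : wt (- m%:Z) - 1 = wt (- m.+1%:Z) + 1 by rewrite weightBz; ring.
  exact: principal_ladder.
- move=> n0; have -> : n = `|n|%N%:Z by lia.
  by apply: pos_up => m; apply: lowest_ladder.
- move=> n0; have -> : n = - `|n|%N%:Z by lia.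
  by apply: pos_down => m; apply: highest_ladder.
- by move=> /eqP ->; exact: norm0.
Qed.

Lemma L_vec_out s n : in_series q a s lam b -> ~~ in_range s n -> e n = 0.
Proof.
case: s => /= hs.
- by [].
- move=> hn; have -> : n = - `|n|%N.-1.+1%:Z by lia.
  by apply: zero_down; apply: lowest_ladder0.
- move=> hn; have -> : n = `|n|%N.-1.+1%:Z by lia.
  by apply: zero_up; apply: highest_ladder0.
- have [h1 h2] := characters_ladder0 q_gt0 hs.
  move=> hn; have [n0|n0] := lerP n 0.
    have -> : n = - `|n|%N.-1.+1%:Z by lia.
    exact: zero_down.
  have -> : n = `|n|%N.-1.+1%:Z by lia.
  exact: zero_up.
Qed.

(** The index map lets one proof serve the index types [int], [nat] and [unit] of the four
    series. *)
Lemma L_basis s (I : eqType) (idx : I -> int) : in_series q a s lam b ->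
  injective idx -> (forall i, in_range s (idx i)) ->
  (forall n, in_range s n -> exists i, n = idx i) ->
  is_basis (fun i => L_vec q t lam b (idx i)) /\ is_posdef lform.
Proof.
move=> hs inj hr hsurj; pose ei i := L_vec q t lam b (idx i).
have h1 i j : i <> j -> lform (ei i) (ei j) = 0.
  by move=> ij; rewrite /ei !L_vecE; apply: L_orth => /inj.
have h2 i : 0 < lform (ei i) (ei i).
  by rewrite /ei L_vecE; apply: L_norm_gt0 hs (hr i).
have h3 v : cspan ei v.
  elim: (L_span v) => [n||x y _ hx _ hy|k x _ hx].
  - have [/hsurj [i ->]|hn] := boolP (in_range s n).
      by rewrite -L_vecE; apply: (@cspan_gen _ _ _ _ _ ei).
    by rewrite (L_vec_out hs hn); apply: cspan0.
  - exact: cspan0.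
  - exact: cspanD.
  - exact: cspanZ.
split.
  exact: (orthogonal_is_basis L_form_sesquilinear h1 h2 h3).
exact: (orthogonal_posdef L_form_sesquilinear h1 h2 h3).
Qed.

End LModule.

(** * Unitary cyclic modules are determined by their vector state *)

Section CyclicEquivalence.
Variables (R : realType) (q t : R).
Local Notation C := (R[i]).
Local Notation U := (Usl2 q t).
Variables (V W : lmodType U) (f : V -> V -> C) (g : W -> W -> C) (v : V) (w : W).
Hypotheses (f_sesq : is_sesquilinear f) (f_pos : is_posdef f) (f_inv : is_invariant f).
Hypotheses (g_sesq : is_sesquilinear g) (g_pos : is_posdef g) (g_inv : is_invariant g).
Hypotheses (v_cyclic : is_cyclic v) (w_cyclic : is_cyclic w).
Hypothesis same_state : forall u, f v (u *: v) = g w (u *: w).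

Let same_form u u' : f (u *: v) (u' *: v) = g (u *: w) (u' *: w).
Proof. by rewrite -[u]ustarK -f_inv -g_inv !scalerA same_state. Qed.

Let posdef_eq0 (V' : lmodType U) (h : V' -> V' -> C) x :
  is_posdef h -> h x x = 0 -> x = 0.
Proof.
by move=> hp hx; apply/eqP/negPn/negP => /hp; rewrite hx ltxx.
Qed.

Let transfer u u' : u *: v = u' *: v <-> u *: w = u' *: w.
Proof.
suff h0 x : x *: v = 0 <-> x *: w = 0.
  have := h0 (u - u'); rewrite !scalerBl => h.
  by split=> /eqP; rewrite -subr_eq0 => /eqP /h /eqP; rewrite subr_eq0 => /eqP.
split=> hx.
  apply: (posdef_eq0 g_pos); rewrite -same_form hx.
  exact: form0l.
apply: (posdef_eq0 f_pos); rewrite same_form hx.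
exact: form0l.
Qed.

(** The uniqueness argument of the GNS construction: u v |-> u w is well defined and isometric,
    because the inner products of u v and u' v are values of the state at u^* u', and a vector of
    norm zero vanishes. *)
Lemma cyclic_equivalence : unitarily_equivalent f g.
Proof.
pose lv x := sval (cid (v_cyclic x)).
have lvK x : lv x *: v = x by rewrite /lv; case: cid.
pose lw x := sval (cid (w_cyclic x)).
have lwK x : lw x *: w = x by rewrite /lw; case: cid.
pose F x : W := lv x *: w.
have FE u : F (u *: v) = u *: w by apply/transfer; rewrite lvK.
have linF : linear F.
  by move=> u x y; rewrite -[x]lvK -[y]lvK scalerA -scalerDl !FE scalerDl scalerA.
pose Fl : {linear V -> W} := HB.pack F (GRing.isLinear.Build U V W _ F linF).
exists Fl; split.
- exists (fun y => lw y *: v) => x.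
    by rewrite /= /F -[RHS]lvK; apply/transfer; rewrite lwK.
  by rewrite /= FE lwK.
- by move=> x y; rewrite /= /F -same_form !lvK.
Qed.

End CyclicEquivalence.

Section VacuumState.
Variables (R : realType) (q a t lam b : R).
Hypotheses (q_gt0 : 0 < q) (q_lt1 : q < 1).
Hypothesis t_def : t = q `^ a - q `^ (- a).
Local Notation C := (R[i]).
Local Notation U := (Usl2 q t).
Local Open Scope complex_scope.

(** If k is the coefficient for u, some p(iB) (u - k) kills the generator of M and hence v. Pairing
    with v turns p(iB) into the nonzero scalar p([b]). *)
Lemma vacuum_state (V : lmodType U) (f : V -> V -> C) (v : V) (u : U) :
  is_sesquilinear f -> is_invariant f -> weight_vector lam b v -> f v v = 1 ->
  f v (u *: v) = weight_coef b (M_one q t lam b) (u *: M_one q t lam b).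
Proof.
move=> f_sesq f_inv hv fv.
have f_uk x : f v (uk q t *: x) = (qbrack q b)%:C * f v x.
  by rewrite f_inv ustar_k hv.1 (formZl f_sesq) conj_real.
have f_poly p x : f v (horner_alg (uk q t) p *: x) = p.[(qbrack q b)%:C] * f v x.
  elim/poly_ind: p x => [|p c IHp] x.
    by rewrite rmorph0 scale0r horner0 mul0r (form0r f_sesq).
  rewrite rmorphD rmorphM /= horner_algX horner_algC !hornerE scalerDl.
  rewrite -scalerA (formDr f_sesq) IHp f_uk scaler_cscale scale1r.
  by rewrite (formZr f_sesq) mulrDl mulrA.
have := weight_coefP q_gt0 q_lt1 t_def (M_one_weight q t lam b)
  (@M_one_cyclic _ q t lam b) (u *: M_one q t lam b).
move: (weight_coef _ _ _) => k [p [p0 hp]].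
have : (horner_alg (uk q t) p * (u - k *: 1)) *: M_one q t lam b = 0.
  by rewrite -scalerA scalerBl scaler_cscale scale1r.
move/(M_one_universal hv); rewrite -scalerA scalerBl scaler_cscale scale1r => h.
have := f_poly p (u *: v - cscale k v); rewrite h (form0r f_sesq) => /esym /eqP.
rewrite mulf_eq0 (negPf p0) (formBr f_sesq) (formZr f_sesq) fv mulr1 subr_eq0.
by move/eqP.
Qed.

End VacuumState.

(** * The listed modules are unitary and mutually inequivalent *)

Section SeriesModules.
Variables (R : realType) (q a t : R).
Hypotheses (q_gt0 : 0 < q) (q_lt1 : q < 1).
Hypothesis t_def : t = q `^ a - q `^ (- a).
Local Notation C := (R[i]).
Local Notation U := (Usl2 q t).
Local Open Scope complex_scope.
Local Notation lform := (L_form q t).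
Local Notation one lam b := (L_class (M_one q t lam b)).

Lemma principal_basis lam b : principal_series q a lam b ->
  is_basis (fun n : int => L_vec q t lam b n) /\ is_posdef (lform lam b).
Proof.
move=> h; apply: (L_basis q_gt0 q_lt1 t_def (s := Principal) (idx := id)) => //.
by move=> n; exists n.
Qed.

Lemma lowest_basis lam b : lowest_weight_series q a lam b ->
  is_basis (fun n : nat => L_vec q t lam b n%:Z) /\ is_posdef (lform lam b).
Proof.
move=> h; apply: (L_basis q_gt0 q_lt1 t_def (s := LowestWeight) (idx := Posz)) => //.
  by move=> m n [].
by case=> // n _; exists n.
Qed.

Lemma highest_basis lam b : highest_weight_series q a lam b ->
  is_basis (fun n : nat => L_vec q t lam b (- n%:Z)) /\ is_posdef (lform lam b).
Proof.
move=> h; apply: (L_basis q_gt0 q_lt1 t_def (s := HighestWeight)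
  (idx := fun n : nat => - n%:Z)) => //.
- by move=> m n /oppr_inj [].
- by move=> n; rewrite /in_range oppr_le0.
- by move=> n hn; exists `|n|%N; move: hn; rewrite /in_range; lia.
Qed.

Lemma character_basis lam b : characters q a lam b ->
  is_basis (fun _ : unit => L_vec q t lam b 0) /\ is_posdef (lform lam b).
Proof.
move=> h; apply: (L_basis q_gt0 q_lt1 t_def (s := Character)
  (idx := fun _ : unit => 0 : int)) => //.
- by case=> [] [].
- by move=> n /eqP ->; exists tt.
Qed.

Lemma L_posdef s lam b : in_series q a s lam b -> is_posdef (lform lam b).
Proof.
case: s => [/principal_basis|/lowest_basis|/highest_basis|/character_basis].
all: by case.
Qed.

Lemma L_one_neq0 lam b : one lam b != 0.
Proof.
apply/eqP => h; have := L_one_norm lam b q_gt0 q_lt1 t_def; rewrite h.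
rewrite (form0r (L_form_sesquilinear lam b q_gt0 q_lt1 t_def)) => /esym /eqP.
by rewrite oner_eq0.
Qed.

Lemma L_unitary_basic s lam b : in_series q a s lam b ->
  is_unitary_basic (lform lam b).
Proof.
move=> h; split.
  split; first exact: (L_form_sesquilinear lam b q_gt0 q_lt1 t_def).
    exact: L_posdef h.
  exact: (L_form_invariant q_gt0 q_lt1 t_def).
exists lam; split.
  exists (one lam b); split; first exact: L_one_neq0.
    exists (qbrack q b)%:C; have [+ _] := L_one_weight q t lam b.
    by rewrite /uk -lock.
  exact: L_one_cyclic.
move=> v; rewrite OmegatE.
exact: (Omega_cyclic q_gt0 q_lt1 t_def v (L_one_weight q t lam b)
  (@L_one_cyclic _ q t lam b)).
Qed.

Definition has_weight (V : lmodType U) (c : R) : Prop :=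
  exists v : V, v != 0 /\ uk q t *: v = cscale (qbrack q c)%:C v.

(** An eigenvector at any other weight would be orthogonal to the spanning family, contradicting
    positivity. *)
Lemma L_has_weight s lam b c : in_series q a s lam b ->
  has_weight (L_mod q t lam b) c <->
  exists n : int, in_range s n /\ c = weight b n.
Proof.
move=> hs; have h_sesq := L_form_sesquilinear lam b q_gt0 q_lt1 t_def.
have h_inv : is_invariant (lform lam b).
  exact: (L_form_invariant q_gt0 q_lt1 t_def).
have h1 := L_one_weight q t lam b.
split=> [[v [v0 hv]]|[n [hn ->]]].
- apply: contrapT => hc; have := L_posdef hs v0.
  suff -> : lform lam b v v = 0 by rewrite ltxx.
  suff h w : lform lam b w v = 0 by apply: h.
  elim: (L_span q_gt0 q_lt1 t_def w) => [n||x y _ hx _ hy|k x _ hx].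
  + have [hn|hn] := boolP (in_range s n); last first.
      by rewrite (L_vec_out q_gt0 q_lt1 t_def hs hn); exact: (form0l h_sesq).
    have [h2 _] := basis_vec_weight q_gt0 q_lt1 n h1.
    apply: (eigen_orth q_gt0 q_lt1 h_sesq h_inv h2 hv) => e.
    exact: hc (ex_intro _ n (conj hn (esym e))).
  + exact: (form0l h_sesq).
  + by rewrite (formDl h_sesq) hx hy addr0.
  + by rewrite (formZl h_sesq) hx mulr0.
- exists (basis_vec b (one lam b) n); split; last first.
    exact: (basis_vec_weight q_gt0 q_lt1 n h1).1.
  apply/eqP => h; have := L_norm_gt0 q_gt0 q_lt1 t_def hs hn.
  by rewrite h (form0l h_sesq) ltxx.
Qed.

Lemma has_weight_equiv (V W : lmodType U) (F : {linear V -> W}) c :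
  bijective F -> has_weight V c <-> has_weight W c.
Proof.
move=> [G FK GK]; have F_inj := can_inj FK.
have F0 v : (F v == 0) = (v == 0).
  by apply/eqP/eqP => [|->]; [rewrite -(raddf0 F) => /F_inj | rewrite raddf0].
have FZ k v : F (cscale k v) = cscale k (F v) by rewrite /cscale linearZ.
split=> [[v [v0 hv]]|[w [w0 hw]]].
  by exists (F v); rewrite F0 v0 -linearZ hv FZ.
exists (G w); rewrite -F0 GK w0; split=> //.
by apply: F_inj; rewrite linearZ /= FZ GK.
Qed.

Lemma equiv_central_value (V W : lmodType U) (F : {linear V -> W}) (v : V)
    (lam lam' : R) : injective F -> v != 0 ->
  (forall x : V, omega q t *: x = cscale lam%:C x) ->
  (forall y : W, omega q t *: y = cscale lam'%:C y) -> lam = lam'.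
Proof.
move=> F_inj v0 hV hW; have h1 : cscale lam%:C (F v) = cscale lam'%:C (F v).
  have -> : cscale lam%:C (F v) = F (cscale lam%:C v) by rewrite /cscale linearZ.
  by rewrite -hV linearZ /= hW.
apply/eqP; rewrite -subr_eq0 -(fmorph_eq0 (real_complex R)) rmorphB.
apply/negPn/negP => l0; case/eqP: v0.
apply: F_inj; rewrite raddf0; apply: (cscale_eq0 l0).
by rewrite cscaleDl h1 -cscaleDl subrr cscale0.
Qed.

Lemma L_omega lam b (v : L_mod q t lam b) : omega q t *: v = cscale lam%:C v.
Proof.
exact: (Omega_cyclic q_gt0 q_lt1 t_def v (L_one_weight q t lam b)
  (@L_one_cyclic _ q t lam b)).
Qed.

Lemma series_inequivalent s s' lam b lam' b' :
  in_series q a s lam b -> in_series q a s' lam' b' ->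
  unitarily_equivalent (lform lam b) (lform lam' b') ->
  [/\ s = s', lam = lam' & b = b'].
Proof.
move=> hs hs' [F [Fbij _]].
have lamE : lam = lam'.
  apply: (equiv_central_value (bij_inj Fbij) (L_one_neq0 lam b)) => x.
    exact: L_omega.
  exact: L_omega.
have wts c : (exists n, in_range s n /\ c = weight b n) <->
    (exists n, in_range s' n /\ c = weight b' n).
  rewrite -(L_has_weight c hs) -(L_has_weight c hs').
  exact: has_weight_equiv Fbij.
have r0 : in_range s' 0 by case: (s').
have [k [_ bk]] : exists k, in_range s k /\ b' = weight b k.
  by apply/wts; exists 0; rewrite weight0.
(* Equal weight sets mean that the two index ranges are translates of each other by k. *)
have shift n : in_range s (n + k) = in_range s' n.
  have wE : weight b (n + k) = weight b' n by rewrite bk /weight intrD; ring.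
  apply/idP/idP => hn.
  - have [m [hm /weight_inj e]] : exists m, in_range s' m /\ weight b' n = weight b' m.
      by apply/wts; exists (n + k).
    by rewrite e.
  - have [m [hm e]] : exists m, in_range s m /\ weight b' n = weight b m.
      by apply/wts; exists n.
    by move: e; rewrite -wE => /weight_inj ->.
suff [-> k0] : s = s' /\ k = 0 by split; rewrite // bk k0 weight0.
(* The ranges are Z, two half-lines and a point; comparing them at and next to the two base points
   tells them apart and locates their end points. *)
have S0 := shift 0; have S1 := shift 1; have Sm := shift (-1).
have Sk := shift (- k); have Sk1 := shift (1 - k); have Skm := shift (- 1 - k).
clear shift wts lamE; move: S0 S1 Sm Sk Sk1 Skm hs hs'.
case: s r0 => r0; case: (s') r0 => r0 //=; try by (move=> *; exfalso; lia).
(* The range Z does not fix k, but b and b' both lie in a half-open window of length 2. *)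
- move=> _ _ _ _ _ _ [/andP[b1 b2] _] [/andP[b3 b4] _]; split=> //.
  apply/eqP; rewrite -(eqr_int R); apply/eqP; move: bk; rewrite /weight.
  by case: (int_cases R k) => // hk; lra.
- by move=> *; split=> //; lia.
- by move=> *; split=> //; lia.
- by move=> *; split=> //; lia.
Qed.

End SeriesModules.

(** * Every unitary basic module occurs in the list *)

Section Classification.
Variables (R : realType) (q a t : R).
Hypotheses (q_gt0 : 0 < q) (q_lt1 : q < 1).
Hypothesis t_def : t = q `^ a - q `^ (- a).
Local Notation C := (R[i]).
Local Notation U := (Usl2 q t).
Local Open Scope complex_scope.
Local Notation lform := (L_form q t).
Variables (V : lmodType U) (f : V -> V -> C).
Hypothesis f_sesq : is_sesquilinear f.
Hypothesis f_pos : is_posdef f.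
Hypothesis f_inv : is_invariant f.

(** iB is self-adjoint and the form is positive, so the eigenvalue is real, and every real number is
    some [b]. *)
Lemma qbrack_eigenvalue (v : V) (mu : C) : v != 0 ->
  uk q t *: v = cscale mu v -> exists b, mu = (qbrack q b)%:C.
Proof.
move=> v0 hv; have := f_inv (uk q t) v v; rewrite ustar_k hv (formZr f_sesq).
rewrite (formZl f_sesq) => /(mulIf (lt0r_neq0 (f_pos v0))) /esym /CrealP.
move/complex_realP => [m ->]; have [b <-] := qbrack_surj q_gt0 q_lt1 m.
by exists b.
Qed.

Variable lam : R.
Local Notation ladder := (ladder q a lam).

Definition cyclic_weight (c : R) (v : V) : Prop :=
  [/\ weight_vector lam c v, v != 0 & is_cyclic v].

Let cyclic_of (x : U) (v w : V) (k : R) : is_cyclic v -> k != 0 ->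
  x *: w = cscale k%:C v -> is_cyclic w.
Proof.
move=> hv k0 hw y; have [u ->] := hv y.
exists ((k%:C)^-1 *: (u * x)).
rewrite scaler_cscale -scalerA hw cscaleC cscaleA mulVf ?cscale1 //.
by rewrite fmorph_eq0.
Qed.

Let ratio_gt0 x y : 0 < qbrace q x / qbrace q y.
Proof. by rewrite divr_gt0 ?qbrace_gt0. Qed.

(** By the norm formula and positivity the ladder value is nonnegative, and it is zero exactly when
    the shift kills v. If it is positive, T^- leads back to a nonzero multiple of v, so the shifted
    vector is again cyclic. *)
Lemma ladder_up c v : cyclic_weight c v ->
  (tplus q t c *: v = 0 /\ ladder (c + 1) = 0) \/
  (cyclic_weight (c + 2) (tplus q t c *: v) /\ 0 < ladder (c + 1)).
Proof.
move=> [hv v0 hc]; have := norm_tplus q_gt0 q_lt1 t_def f_sesq f_inv hv.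
have fv := f_pos v0; have rg := ratio_gt0 c (c + 2).
have [->|w0] := eqVneq (tplus q t c *: v) 0.
  rewrite (form0l f_sesq) => /esym /eqP; rewrite mulf_eq0 (gt_eqF fv) orbF.
  by rewrite fmorph_eq0 mulf_eq0 (gt_eqF rg) => /eqP; left.
move=> hn; have := f_pos w0; rewrite hn pmulr_lgt0 // ltcR pmulr_rgt0 // => l.
right; split=> //; split=> //; first exact: weight_vector_tplus.
exact: cyclic_of hc (lt0r_neq0 l) (tminus_tplus_weight q_gt0 t_def hv).
Qed.

Lemma ladder_down c v : cyclic_weight c v ->
  (tminus q t c *: v = 0 /\ ladder (c - 1) = 0) \/
  (cyclic_weight (c - 2) (tminus q t c *: v) /\ 0 < ladder (c - 1)).
Proof.
move=> [hv v0 hc]; have := norm_tminus q_gt0 q_lt1 t_def f_sesq f_inv hv.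
have fv := f_pos v0; have rg := ratio_gt0 c (c - 2).
have [->|w0] := eqVneq (tminus q t c *: v) 0.
  rewrite (form0l f_sesq) => /esym /eqP; rewrite mulf_eq0 (gt_eqF fv) orbF.
  by rewrite fmorph_eq0 mulf_eq0 (gt_eqF rg) => /eqP; left.
move=> hn; have := f_pos w0; rewrite hn pmulr_lgt0 // ltcR pmulr_rgt0 // => l.
right; split=> //; split=> //; first exact: weight_vector_tminus.
exact: cyclic_of hc (lt0r_neq0 l) (tplus_tminus_weight q_gt0 t_def hv).
Qed.

(** The zeros at b - 1 and b + 1 must come from the same factor, since the two factors force
    opposite signs of lam. Equal braces then mean equal absolute values, which gives b = -a or b =
    a. *)
Lemma series_character b : ladder (b - 1) = 0 -> ladder (b + 1) = 0 ->
  characters q a lam b.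
Proof.
move=> /ladder_eq0 h1 /ladder_eq0 h2; rewrite /characters -qbrace1 //.
have B := qbrace_gt0 q_gt0.
case: h1 => h1; case: h2 => h2.
- left; have /(qbrace_eq q_gt0 q_lt1) e :
      qbrace q (a + (b - 1)) = qbrace q (a + (b + 1)).
    by apply: oppr_inj; rewrite -h1 -h2.
  have ab : b = - a.
    by move: e; case: (ger0P (_ + (b - 1))); case: (ger0P (_ + (b + 1))); lra.
  by split=> //; rewrite h2; congr (- qbrace q _); rewrite ab; ring.
- have := B (a + (b - 1)); have := B (a - (b + 1)); lra.
- have := B (a + (b + 1)); have := B (a - (b - 1)); lra.
- right; have /(qbrace_eq q_gt0 q_lt1) e :
      qbrace q (a - (b - 1)) = qbrace q (a - (b + 1)) by rewrite -h1 -h2.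
  have ab : b = a.
    by move: e; case: (ger0P (_ - (b - 1))); case: (ger0P (_ - (b + 1))); lra.
  by split=> //; rewrite h1; congr (qbrace q _); rewrite ab; ring.
Qed.

(** The zero at b - 1 fixes lam; the strict inequality at b + 1 then compares two braces, hence two
    absolute values, and this is the condition b > -a or b > a. *)
Lemma series_lowest b : ladder (b - 1) = 0 -> 0 < ladder (b + 1) ->
  lowest_weight_series q a lam b.
Proof.
move=> /ladder_eq0 h1; rewrite (ladder_gt0 _ _ q_gt0) => /andP[h2 h3].
case: h1 => h1; [left | right].
- split; last by rewrite h1 addrA.
  move: h2; rewrite h1 ltrN2 qbrace_lt //.
  by case: (ger0P (_ + (b - 1))); case: (ger0P (_ + (b + 1))); lra.
- split; last by rewrite h1; congr (qbrace q _); ring.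
  move: h3; rewrite h1 qbrace_lt //.
  by case: (ger0P (_ - (b - 1))); case: (ger0P (_ - (b + 1))); lra.
Qed.

Lemma series_highest b : 0 < ladder (b - 1) -> ladder (b + 1) = 0 ->
  highest_weight_series q a lam b.
Proof.
rewrite (ladder_gt0 _ _ q_gt0) => /andP[h2 h3] /ladder_eq0 h1.
case: h1 => h1; [left | right].
- split; last by rewrite h1 addrA.
  move: h2; rewrite h1 ltrN2 qbrace_lt //.
  by case: (ger0P (_ + (b - 1))); case: (ger0P (_ + (b + 1))); lra.
- split; last by rewrite h1; congr (qbrace q _); ring.
  move: h3; rewrite h1 qbrace_lt //.
  by case: (ger0P (_ - (b - 1))); case: (ger0P (_ - (b + 1))); lra.
Qed.

Lemma weight_window (b0 c : R) : exists n, c - 2 < weight b0 n <= c.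
Proof.
exists (Num.floor ((c - b0) / 2)); rewrite /weight.
have := floor_itv ((c - b0) / 2); move: (Num.floor _) => n.
by rewrite intrD => /andP[h1 h2]; apply/andP; split; lra.
Qed.

Lemma cyclic_weight_series b0 v0 : cyclic_weight b0 v0 ->
  exists s b v, in_series q a s lam b /\ cyclic_weight b v.
Proof.
move=> h0.
have [[c [w [hw w0]]]|no_low] :=
    pselect (exists c w, cyclic_weight c w /\ tminus q t c *: w = 0).
  have l0 : ladder (c - 1) = 0.
    by have [[]//|[[_ /eqP]]] := ladder_down hw.
  have [[_ l1]|[_ l1]] := ladder_up hw.
    by exists Character, c, w; split=> //; apply: series_character.
  by exists LowestWeight, c, w; split=> //; apply: series_lowest.
have [[c [w [hw w0]]]|no_high] :=
    pselect (exists c w, cyclic_weight c w /\ tplus q t c *: w = 0).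
  have l0 : ladder (c + 1) = 0.
    by have [[]//|[[_ /eqP]]] := ladder_up hw.
  have [[h _]|[_ l1]] := ladder_down hw; first by case: no_low; exists c, w.
  by exists HighestWeight, c, w; split=> //; apply: series_highest.
(* With neither a lowest nor a highest weight vector, every shift is nonzero and the whole coset b0
   + 2Z consists of weights with cyclic vectors. *)
have all_n n : exists w, cyclic_weight (weight b0 n) w.
  elim/int_rect: n => [|n [w hw]|n [w hw]].
  - by exists v0; rewrite weight0.
  - rewrite weightSz; have [[h _]|[h _]] := ladder_up hw; last first.
      by exists (tplus q t (weight b0 n) *: w).
    by case: no_high; exists (weight b0 n), w.
  - rewrite weightBz; have [[h _]|[h _]] := ladder_down hw; last first.
      by exists (tminus q t (weight b0 (- n%:Z)) *: w).
    by case: no_low; exists (weight b0 (- n%:Z)), w.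
have all_pos n : 0 < ladder (weight b0 n + 1).
  have [w hw] := all_n n.
  have [[h _]|[_ //]] := ladder_up hw.
  by case: no_high; exists (weight b0 n), w.
have [n /andP[n1 n2]] := weight_window b0 a.
have [m /andP[m1 m2]] := weight_window b0 (- a).
have [w hw] := all_n n; exists Principal, (weight b0 n), w; split=> //.
split; first by rewrite n1.
exists (weight b0 m); split; first by rewrite m1.
  by exists (m - n); rewrite /weight intrB; ring.
(* The weight in the window below -a serves as b' and supplies the lower bound on lam; the one below
   a serves as b and supplies the upper bound. *)
have := all_pos n; have := all_pos m; rewrite !(ladder_gt0 _ _ q_gt0).
by rewrite !opprD !addrA => /andP[-> _] /andP[_ ->].
Qed.

Lemma cyclic_weight_equiv s b v : in_series q a s lam b -> cyclic_weight b v ->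
  unitarily_equivalent f (lform lam b).
Proof.
move=> hs [hv v0 hc]; have fv := f_pos v0.
have [x fvE] : exists x, f v v = x%:C by apply/complex_realP/gtr0_real.
have x0 : 0 < x by move: fv; rewrite fvE ltcR.
(* The vector is normalized so that its state can be compared with that of the generator of L, which
   has norm 1. *)
pose r := (Num.sqrt x)^-1; pose w := cscale r%:C v.
have r0 : r != 0 by rewrite invr_eq0 gt_eqF ?sqrtr_gt0.
have fw : f w w = 1.
  rewrite (formZl f_sesq) (formZr f_sesq) conj_real fvE -!rmorphM mulrA.
  by rewrite -invfM -expr2 sqr_sqrtr ?ltW // mulVf ?rmorph1 ?gt_eqF.
have hw : weight_vector lam b w by apply: weight_vectorZ.
have cw : is_cyclic w by apply: (cyclic_of (x := 1) hc r0); rewrite scale1r.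
have l_sesq := L_form_sesquilinear lam b q_gt0 q_lt1 t_def.
have l_inv : is_invariant (lform lam b) by exact: (L_form_invariant q_gt0 q_lt1 t_def).
apply: (cyclic_equivalence f_sesq f_pos f_inv l_sesq (L_posdef q_gt0 q_lt1 t_def hs)
  l_inv cw (@L_one_cyclic _ q t lam b)) => u.
rewrite (vacuum_state q_gt0 q_lt1 t_def u f_sesq f_inv hw fw).
rewrite (vacuum_state q_gt0 q_lt1 t_def u l_sesq l_inv (L_one_weight q t lam b)) //.
exact: L_one_norm q_gt0 q_lt1 t_def.
Qed.

End Classification.

Lemma unitary_basic_classification (R : realType) (q a t : R)
    (V : lmodType (Usl2 q t)) (f : V -> V -> R[i]) :
  0 < q -> q < 1 -> t = q `^ a - q `^ (- a) -> is_unitary_basic f ->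
  exists s lam b, in_series q a s lam b /\
    unitarily_equivalent f (L_form q t lam b).
Proof.
move=> q_gt0 q_lt1 t_def [[f_sesq f_pos f_inv] [lam [[v [v0 [mu hmu] hc]] hO]]].
have hk : uk q t *: v = cscale mu v by rewrite /uk -lock.
have [b0 mub] := qbrack_eigenvalue q_gt0 q_lt1 f_sesq f_pos f_inv v0 hk.
rewrite mub in hk.
have hv : cyclic_weight lam b0 v.
  split=> //; split=> //.
  by rewrite -(Omega_weight q_gt0 q_lt1 hk) -OmegatE hO.
have [s [b [w [hs hw]]]] :=
  cyclic_weight_series q_gt0 q_lt1 t_def f_sesq f_pos f_inv hv.
exists s, lam, b; split=> //.
exact: (cyclic_weight_equiv q_gt0 q_lt1 t_def f_sesq f_pos f_inv hs hw).
Qed.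

Theorem theorem3p16 (R : realType) (q a t : R)
  (q_gt0 : 0 < q) (q_lt1 : q < 1) (t_def : t = q `^ a - q `^ (- a)) :
  (forall (s : series) (lam b : R), in_series q a s lam b ->
     is_unitary_basic (L_form q t lam b)) /\
  (forall (V : lmodType (Usl2 q t)) (f : V -> V -> R[i]), is_unitary_basic f ->
     exists (s : series) (lam b : R), in_series q a s lam b /\
       unitarily_equivalent f (L_form q t lam b)) /\
  (forall (s s' : series) (lam b lam' b' : R),
     in_series q a s lam b -> in_series q a s' lam' b' ->
     unitarily_equivalent (L_form q t lam b) (L_form q t lam' b') ->
     [/\ s = s', lam = lam' & b = b']) /\
  (forall lam b : R, principal_series q a lam b ->
     is_basis (fun n : int => L_vec q t lam b n)) /\
  (forall lam b : R, lowest_weight_series q a lam b ->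
     is_basis (fun n : nat => L_vec q t lam b n%:Z)) /\
  (forall lam b : R, highest_weight_series q a lam b ->
     is_basis (fun n : nat => L_vec q t lam b (- n%:Z))) /\
  (forall lam b : R, characters q a lam b ->
     one_dimensional (L_mod q t lam b)).
Proof.
split; first by move=> s lam b; apply: L_unitary_basic.
split; first by move=> V f; apply: unitary_basic_classification.
split; first by move=> s s' lam b lam' b'; apply: series_inequivalent.
split; first by move=> lam b /(principal_basis q_gt0 q_lt1 t_def) [].
split; first by move=> lam b /(lowest_basis q_gt0 q_lt1 t_def) [].
split; first by move=> lam b /(highest_basis q_gt0 q_lt1 t_def) [].
move=> lam b /(character_basis q_gt0 q_lt1 t_def) [h _].
by exists (L_vec q t lam b 0).
Qed.
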